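(* Let $n\ge 0$, let $f$ be a complex polynomial of degree $n+1$ with $n+1$ distinct nonzero roots $a_0,\dots,a_n$, $|a_0|>\cdots>|a_n|$, and let $X=\{(x,y,z)\in\mathbb C^2\times\mathbb C^\times: xy=f(z)\}$ with the symplectic form $\omega$ restricted from the standard one, and let $\mathcal B_{cc}^{(k)}=(X,L^{\otimes k},\nabla^{L^{\otimes k}})$, $k\in\mathbb Z_{>0}$, be the space-filling coisotropic A-brane of $(X,k\omega)$ described in the context. For each level $k\in\mathbb Z_{>0}$ and each $(x,\check y)\in\check X_0$, there is an action $$\mathrm{Hom}_A(\mathcal B_{cc}^{(k)},\mathcal B_{cc}^{(k)})\otimes\mathrm{Hom}_A(\mathcal B_{(x,\check y)},\mathcal B_{cc}^{(k)})\to\mathrm{Hom}_A(\mathcal B_{(x,\check y)},\mathcal B_{cc}^{(k)})$$ of the algebra $\mathrm{Hom}_A(\mathcal B_{cc}^{(k)},\mathcal B_{cc}^{(k)})=(H^\bullet(B,\mathcal A_X^{(k)}),\star_{k^{-1}})$ on the vector space $\mathrm{Hom}_A(\mathcal B_{(x,\check y)},\mathcal B_{cc}^{(k)})=H^0(F_x,L^{\otimes k}|_{F_x}\otimes\mathcal L_{\check y}^*\otimes\sqrt{K_x})$.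
   Context: **Base and charts.** $\omega$ is the restriction of $\frac{\sqrt{-1}}2\big(dx\wedge d\bar x+dy\wedge d\bar y+\frac{dz\wedge d\bar z}{|z|^2}\big)$. The map $p:X\to B=\mathbb R^2$, $p(x,y,z)=(s,\lambda)=(-\log|z|,\frac12(|x|^2-|y|^2))$, is a proper Lagrangian torus fibration with nodal fibers over $(s_i,0)$, $s_i=-\log|a_i|$, $s_0<\dots<s_n$. Put $s_{-1}=-\infty$, $s_{n+1}=+\infty$, $B^{sm}=B\setminus\{(s_i,0)\}_i$, $B^\pm=\{\pm\lambda>0\}$, $B_i=(s_{i-1},s_{i+1})\times\mathbb R$, $B_i^\pm=B_i\cap B^\pm$, $U_i^-=B_i\setminus((s_{i-1},s_i]\times\{0\})$, $U_i^+=B_i\setminus([s_i,s_{i+1})\times\{0\})$, so $U_i^+\cap U_i^-=B_i^+\sqcup B_i^-$. Each $U=U_i^\pm$ carries integral affine (action) coordinates $(x_1,x_2)$, with angle coordinates $(y^1,y^2)$ on $X_U=p^{-1}(U)$, $\omega=dx_1\wedge dy^1+dx_2\wedge dy^2$; $x_2$ is global, vanishes on $\lambda=0$, and is positive on $B^+$, negative on $B^-$. **The brane and its endomorphism algebra.** On $X_U$ set $u=e^{\pi(x_1-2\sqrt{-1}y^2)}$, $w=e^{\pi(x_2+2\sqrt{-1}y^1)}$. The complex structure $I$ on $X$ (structure sheaf $\mathcal O_X$) has these as holomorphic coordinates on the charts, glued by: $w$ is global; $u_{U_i^+}=u_{U_i^-}(1+w^{-1})$ on $X_{B_i^+}$;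 $u_{U_i^+}=u_{U_i^-}w^{-1}(1+w)$ on $X_{B_i^-}$; $u_{U_i^+}=u_{U_{i+1}^-}$. The $U(1)$-line bundle $(L,\nabla^L)$ on $X$ is given on each chart by the automorphy factor $\exp(4\pi\sqrt{-1}m^2y^1)$ (for the shift $y\mapsto y+m$, $m=(m^1,m^2)\in\mathbb Z^2$) and the connection $d-2\pi\sqrt{-1}(\frac12x_1dx_2+2y^2dy^1)$, glued by $G_{U_{i+1}^-U_i^+}=1$ and $G_{U_i^-U_i^+}=\exp(-\frac{\sqrt{-1}}\pi\mathrm{Re}\,\mathrm{Li}_2(-w^{-1}))$ on $X_{B_i^+}$, $G_{U_i^-U_i^+}=\exp(2\pi\sqrt{-1}(\frac14x_2^2-(y^1)^2))\exp(-\frac{\sqrt{-1}}\pi\mathrm{Re}\,\mathrm{Li}_2(-w))$ on $X_{B_i^-}$. Let $q=e^{-\pi\sqrt{-1}/k}$, $q^r=e^{-r\pi\sqrt{-1}/k}$ for $r\in\mathbb Q$. Expanding $f=\sum_{m\in\mathbb Z^2}\hat f_mu^{m^1}w^{m^2}$, $g=\sum_m\hat g_mu^{m^1}w^{m^2}\in H^0(X_U,\mathcal O_X)$, put $f\star_{k^{-1}}g=\sum_{m,m'}q^{\frac12(m^1m'^2-m'^1m^2)}\hat f_m\hat g_{m'}u^{m^1+m'^1}w^{m^2+m'^2}$. $\mathcal A_X^{(k)}$ is the sheaf of algebras on $B$ obtained by gluing the algebras $(H^0(X_U,\mathcal O_X),\star_{k^{-1}})$, $U=U_i^\pm$ (and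 those on open subsets), by $u_{U_i^+}=u_{U_i^-}(1+w^{-2k})^{1/2k}$ on $X_{B_i^+}$, $u_{U_i^+}=u_{U_i^-}w^{-1}(1+w^{2k})^{1/2k}$ on $X_{B_i^-}$, $u_{U_i^+}=u_{U_{i+1}^-}$, $w$ global (principal branch, $1^{1/2k}=1$); sections over an open set containing some $(s_i,0)$ are the sections over the complement of these points respecting the gluing. The product on $H^\bullet(B,\mathcal A_X^{(k)})$ is induced by $\star_{k^{-1}}$ and cup product. **Lagrangian branes.** $\check X_0=TB^{sm}/T_{\mathbb Z}B^{sm}$ is the dual torus fibration. A point $(x,\check y)\in\check X_0$ ($x\in B^{sm}$, $\check y\in T_xB^{sm}/T_{\mathbb Z,x}B^{sm}$) is identified with the Lagrangian A-brane $\mathcal B_{(x,\check y)}=(F_x,\mathcal L_{\check y})$, where $F_x=p^{-1}(x)$ is the (smooth) torus fiber and $\mathcal L_{\check y}$ is the flat $U(1)$-line bundle on $F_x$ corresponding to $\check y$ in the dual torus. An auxiliary flat complex structure on $F_x$ is chosen, $\sqrt{K_x}$ is a half-form bundle (square root of the canonical bundle) of $F_x$ for this complex structure, and $\mathrm{Hom}_A(\mathcal B_{(x,\check y)},\mathcal B_{cc}^{(k)}):=H^0(F_x,L^{\otimes k}|_{F_x}\otimes\mathcal L_{\check y}^*\otimes\sqrt{K_x})$ is the Kähler polarized Hilbert space (holomorphic sections); it is the fiber $\check E^{(k)}_{(x,\check y)}$ at $(x,\check y)$ of the rank $2k$ mirror bundle $\check E^{(k)}$. An action means a unital left module structure.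
   Formalization: In the gluing of A_X^(k), the factors (1+w^{∓2k})^{1/2k} are multiplied with the star product: taken as a commutative substitution, the printed formula is not multiplicative for odd powers of u (compare u⋆u). For even powers of u nothing changes. *)

(* Defs.v *)
(* Mathematical Components and MathComp-Analysis; [R] is any [realType] and the
   complex numbers are [R[i]]. *)
From HB Require Import structures.
From mathcomp Require Export all_boot all_order all_algebra.
From mathcomp Require Export complex.
From mathcomp Require Export all_classical all_reals all_analysis.
Import Order.TTheory GRing.Theory Num.Theory.
Export numFieldNormedType.Exports.

Set Implicit Arguments.
Unset Strict Implicit.
Unset Printing Implicit Defensive.

Local Open Scope classical_set_scope.
Local Open Scope complex_scope.
Local Open Scope ring_scope.

Section Analysis.
Variable R : realType.
Local Notation C := R[i].

Definition cI : C := 0 +i* 1.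

Definition cexp (z : C) : C :=
  (expR (complex.Re z))%:C * (cos (complex.Im z) +i* sin (complex.Im z)).

Section Derivatives.
Variable V : normedModType R.

(* C^oo on an open set [D]: all iterated directional derivatives exist and are
   (totally) differentiable on [D]. *)
Definition smooth (D : set V) (g : V -> R) : Prop :=
  forall (vs : seq V) (p : V), D p ->
    differentiable (foldr (fun v (h : V -> R) => 'D_v h) g vs) p.

Definition csmooth (D : set V) (g : V -> C) : Prop :=
  smooth D (fun p => complex.Re (g p)) /\ smooth D (fun p => complex.Im (g p)).

Definition cder (g : V -> C) (v p : V) : C :=
  'D_v (fun p => complex.Re (g p)) p +i* 'D_v (fun p => complex.Im (g p)) p.
End Derivatives.

(* Sum of an absolutely summable family, in no particular order. *)
Definition rsum (T : choiceType) (g : T -> R) : R :=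
  fine (\esum_(t in [set: T]) (Num.max (g t) 0)%:E
        - \esum_(t in [set: T]) (Num.max (- g t) 0)%:E)%E.

Definition csum (T : choiceType) (g : T -> C) : C :=
  rsum (fun t => complex.Re (g t)) +i* rsum (fun t => complex.Im (g t)).

Definition rint2 (g : R * R -> R) : R :=
  (\int[lebesgue_measure]_(s in `[0, 1]%classic)
     (\int[lebesgue_measure]_(t in `[0, 1]%classic) g (s, t))).

Definition cint2 (g : R * R -> C) : C :=
  rint2 (fun y => complex.Re (g y)) +i* rint2 (fun y => complex.Im (g y)).

(* Coefficient of [t ^ j] in the principal branch of [(1 + t) ^ al]. *)
Definition gbin (al : R) (j : nat) : R :=
  (\prod_(l < j) (al - l%:R)) / j`!%:R.

End Analysis.

Section Geometry.
Variables (R : realType) (n : nat).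
Local Notation C := R[i].
Local Notation B := (R * R)%type.
Local Notation C3 := (C * C * C)%type.
(* (x, y) = ((x_1, x_2), (y^1, y^2)) *)
Local Notation coord4 := ((R * R) * (R * R))%type.

Variable f : {poly C}.
Variable a : 'I_n.+1 -> C.

Definition totalX : set C3 := [set P | P.1.1 * P.1.2 = f.[P.2] /\ P.2 != 0].

Definition fib (P : C3) : B :=
  (- ln (Normc.normc P.2), (Normc.normc P.1.1 ^+ 2 - Normc.normc P.1.2 ^+ 2) / 2).

Definition omega (P v w : C3) : R :=
  let d (s t : C) : C := s * t^* - s^* * t in
  complex.Re (cI R / 2 * (d v.1.1 w.1.1 + d v.1.2 w.1.2
                          + d v.2 w.2 / (Normc.normc P.2 ^+ 2)%:C)).

Definition node (i : 'I_n.+1) : R := - ln (Normc.normc (a i)).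

(* [strip i] is B_i; the bounds s_{-1} and s_{n+1} are infinite. *)
Definition strip (i : 'I_n.+1) : set B :=
  [set b | forall j : 'I_n.+1,
      (j.+1 = i :> nat -> node j < b.1) /\ (i.+1 = j :> nat -> b.1 < node j)].

Definition chart := ('I_n.+1 * bool)%type.

(* [(i, false)] is U_i^- and [(i, true)] is U_i^+.  For [swap = false], U_i^-
   omits the half-line s <= s_i of {lambda = 0} inside B_i and U_i^+ the
   half-line s >= s_i; for [swap = true] the two cuts are exchanged, so that
   U_i^+ meets U_{i+1}^- in the whole strip (s_i, s_{i+1}) x R. *)
Definition chart_dom (swap : bool) (U : chart) : set B :=
  [set b | strip U.1 b /\
     ~ (b.2 = 0 /\ if U.2 (+) swap then node U.1 <= b.1 else b.1 <= node U.1)].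

Record chart_data := ChartData {
  action : chart -> B -> R * R;
  param : chart -> coord4 -> C3
}.

Definition ucoord (p : coord4) : C :=
  cexp ((pi * p.1.1)%:C - cI R * (2 * pi * p.2.2)%:C).
Definition wcoord (p : coord4) : C :=
  cexp ((pi * p.1.2)%:C + cI R * (2 * pi * p.2.1)%:C).

Definition mono (m : int * int) (p : coord4) : C :=
  ucoord p ^ m.1 * wcoord p ^ m.2.

Section Charts.
Variables (swap : bool) (cd : chart_data).
Local Notation dom := (chart_dom swap).

Definition chart_image (U : chart) (W : set B) : set coord4 :=
  [set p | exists2 b, (W `&` dom U) b & p.1 = action cd U b].

(* The angles of a point are only defined up to Z^2, which none of the
   functions below can see. *)
Definition coords (U : chart) (P : C3) : coord4 :=
  (action cd U (fib P), xget (0, 0) [set y | param cd U (action cd U (fib P), y) = P]).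

(* [action cd U] are action coordinates on [U] and [param cd U] is the inverse of
   the action-angle coordinates on p^-1(U), viewed as a Z^2-periodic map. *)
Definition is_action_angle_chart (U : chart) : Prop :=
  [/\ smooth (dom U) (fun b => (action cd U b).1) /\
      smooth (dom U) (fun b => (action cd U b).2),
      open (action cd U @` dom U) /\
      [/\ csmooth (chart_image U setT) (fun p => (param cd U p).1.1),
          csmooth (chart_image U setT) (fun p => (param cd U p).1.2) &
          csmooth (chart_image U setT) (fun p => (param cd U p).2)],
      (forall b y, dom U b ->
         totalX (param cd U (action cd U b, y)) /\
         fib (param cd U (action cd U b, y)) = b) /\
      (forall P, totalX P -> dom U (fib P) ->
         exists y, param cd U (action cd U (fib P), y) = P),
      (forall b y y', dom U b ->
         (param cd U (action cd U b, y) = param cd U (action cd U b, y') <->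
          exists m : int * int, y' = (y.1 + m.1%:~R, y.2 + m.2%:~R))) &
      forall p v w, chart_image U setT p ->
        let dparam v : C3 := (cder (fun p => (param cd U p).1.1) v p,
                            cder (fun p => (param cd U p).1.2) v p,
                            cder (fun p => (param cd U p).2) v p) in
        omega (param cd U p) (dparam v) (dparam w) =
          (v.1.1 * w.2.1 - w.1.1 * v.2.1) + (v.1.2 * w.2.2 - w.1.2 * v.2.2)].

Definition is_action_angle_atlas : Prop :=
  [/\ (forall U, is_action_angle_chart U),
      (forall U U' b, dom U b -> dom U' b -> (action cd U b).2 = (action cd U' b).2),
      (forall U b, dom U b ->
         [/\ b.2 = 0 -> (action cd U b).2 = 0,
             0 < b.2 -> 0 < (action cd U b).2 &
             b.2 < 0 -> (action cd U b).2 < 0]) &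
      forall U U' P, totalX P -> dom U (fib P) -> dom U' (fib P) ->
        wcoord (coords U P) = wcoord (coords U' P)].

(* Functions on p^-1(W `&` U) that are holomorphic for the complex structure
   with holomorphic coordinates u, w: smooth, with dg a combination of du and
   dw at each point. *)
Definition holomorphic (U : chart) (W : set B) (g : C3 -> C) : Prop :=
  csmooth (chart_image U W) (g \o param cd U) /\
  forall p, chart_image U W p -> exists al be : C, forall v,
    cder (g \o param cd U) v p = al * cder ucoord v p + be * cder wcoord v p.

(* Coefficient of u^(m.1) w^(m.2) in the Laurent expansion of [g] along the
   fibre over [b]; it is locally constant in [b]. *)
Definition coef (U : chart) (g : C3 -> C) (b : B) (m : int * int) : C :=
  cint2 (fun y => g (param cd U (action cd U b, y)) * mono (- m) (action cd U b, y)).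

Section Level.
Variable k : nat.

Definition qpow (r : R) : C := cexp (- (cI R * (r * pi / k%:R)%:C)).

Definition phase (m m' : int * int) : C :=
  qpow ((m.1 * m'.2 - m'.1 * m.2)%:~R / 2).

Definition star_chart (U : chart) (g h : C3 -> C) : C3 -> C := fun P =>
  csum (fun mm : (int * int) * (int * int) =>
    phase mm.1 mm.2 * coef U g (fib P) mm.1 * coef U h (fib P) mm.2
    * mono (mm.1 + mm.2) (coords U P)).

(* The gluing map from U_i^+ to U_i^- is the morphism of star-algebras
   u^m1 w^m2 |-> (u^m1 w^m2) * (1 + w^(-2k))^(m1/2k) for lambda > 0,
   u^m1 w^m2 |-> (u^m1 w^(m2-m1)) * (1 + w^(2k))^(m1/2k) for lambda < 0,
   where the starred product is taken in the algebra, in which w^(2k) is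
   central; the value at [m] below is the coefficient of u^(m.1) w^(m.2) in the
   image of the series with coefficients [c].  For m1 odd the substitution
   with the commutative product would not be multiplicative for star. *)
Definition glue (above : bool) (c : int * int -> C) (m : int * int) : C :=
  csum (fun j : nat =>
    let d : int := (2 * k * j)%N%:Z in
    (gbin (m.1%:~R / (2 * k)%:R) j)%:C *
    if above then phase (m.1, m.2 + d) (0, - d) * c (m.1, m.2 + d)
    else phase (m.1, m.2 - d) (0, d) * c (m.1, m.2 - d + m.1)).

(* Sections of A_X^(k): one function per chart, compatible on overlaps.  The
   charts cover B minus the nodes, so nothing is asked over the nodes. *)
Definition presection := chart -> C3 -> C.

Definition is_section (W : set B) (s : presection) : Prop :=
  [/\ forall U, holomorphic U W (s U),
      forall i b m, W b -> dom (i, true) b -> dom (i, false) b ->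
        coef (i, false) (s (i, false)) b m =
        glue (0 < b.2) (coef (i, true) (s (i, true)) b) m &
      forall (i j : 'I_n.+1) b m, j = i.+1 :> nat ->
        W b -> dom (i, true) b -> dom (j, false) b ->
        coef (i, true) (s (i, true)) b m = coef (j, false) (s (j, false)) b m].

Definition section_eq (W : set B) (s t : presection) : Prop :=
  forall U P, totalX P -> W (fib P) -> dom U (fib P) -> s U P = t U P.

Definition star (s t : presection) : presection :=
  fun U => star_chart U (s U) (t U).

(* Cech cohomology of A_X^(k), all degrees at once: on an open cover [cU], a
   cochain of total degree is a family indexed by nonempty finite sequences of
   members of [cU]; sequences of size p.+1 carry its component of degree p. *)
Definition cover := set (set B).
Definition cochain := seq (set B) -> presection.

Definition is_open_cover (cU : cover) : Prop :=
  (forall W, cU W -> open W) /\ forall b, exists2 W, cU W & W b.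

Definition inter (sg : seq (set B)) : set B := \big[setI/setT]_(W <- sg) W.

Definition simplex (cU : cover) (sg : seq (set B)) : Prop :=
  sg <> [::] /\ forall W, W \in sg -> cU W.

Definition is_cochain (cU : cover) (c : cochain) : Prop :=
  (forall sg, simplex cU sg -> is_section (inter sg) (c sg)) /\
  exists N, forall sg, simplex cU sg -> (N < size sg)%N ->
    section_eq (inter sg) (c sg) (fun _ _ => 0).

Definition coboundary (c : cochain) : cochain := fun sg U P =>
  if (size sg <= 1)%N then 0
  else \sum_(i < size sg) (-1) ^+ i * c (take i sg ++ drop i.+1 sg) U P.

Definition is_cocycle (cU : cover) (c : cochain) : Prop :=
  is_cochain cU c /\ forall sg, simplex cU sg ->
    section_eq (inter sg) (coboundary c sg) (fun _ _ => 0).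

Definition cup (c d : cochain) : cochain := fun sg U P =>
  \sum_(i < size sg) star (c (take i.+1 sg)) (d (drop i sg)) U P.

Definition cochain1 : cochain := fun sg _ _ => (size sg == 1%N)%:R.

Definition refines (cW cU : cover) (r : set B -> set B) : Prop :=
  forall W, cW W -> cU (r W) /\ W `<=` r W.

(* Equality of classes in the colimit over open covers. *)
Definition cohomologous (cU : cover) (c : cochain) (cV : cover) (d : cochain) :
    Prop :=
  exists cW r r' e,
    [/\ is_open_cover cW, refines cW cU r, refines cW cV r', is_cochain cW e &
        forall sg, simplex cW sg ->
          section_eq (inter sg)
            (fun U P => c (map r sg) U P - d (map r' sg) U P)
            (coboundary e sg)].

Section Hilbert.
Variables (U : chart) (b : B).

Definition conn_L (p v : coord4) : C :=
  - (cI R * (2 * pi * (p.1.1 * v.1.2 / 2 + 2 * p.2.2 * v.2.1))%:C).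

Definition factor_L (m : int * int) (y : R * R) : C :=
  cexp (cI R * (4 * pi * m.2%:~R * y.1)%:C).

(* The flat bundle of y-check = sum_j yc_j d/dx_j is the trivial one on F_x
   with connection d - 2 pi i sum_j yc_j dy^j; integral shifts of [yc] are gauge
   transformations. *)
Definition conn_flat (yc v : R * R) : C :=
  - (cI R * (2 * pi * (yc.1 * v.1 + yc.2 * v.2))%:C).

(* With F_x = R^2/Z^2 through the angle coordinates, a flat complex structure
   is a constant endomorphism of square -1 of the tangent space R^2. *)
Definition flat_complex_structure (J : R * R -> R * R) : Prop :=
  (forall v w : R * R, J (v + w) = J v + J w) /\
  (forall (t : R) (v : R * R), J (t * v.1, t * v.2) = (t * (J v).1, t * (J v).2)) /\
  (forall v : R * R, J (J v) = - v).

(* A constant (1,0)-form trivialises K, so a square root of K is the flat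
   bundle of a character Z^2 -> {1, -1}, given by the two signs [eps]. *)
Definition factor_K (eps : bool * bool) (m : int * int) : C :=
  (-1) ^ (m.1 *+ eps.1 + m.2 *+ eps.2).

Definition nabla (yc : R * R) (psi : R * R -> C) (v y : R * R) : C :=
  cder psi v y
  + (conn_L (action cd U b, y) (0, v) *+ k - conn_flat yc v) * psi y.

(* H^0(F_x, L^k (x) L_yc^* (x) sqrt K), as quasi-periodic functions on R^2. *)
Definition polarized (yc : R * R) (J : R * R -> R * R) (eps : bool * bool)
    : set (R * R -> C) :=
  [set psi : R * R -> C |
    [/\ csmooth setT psi,
        forall (m : int * int) (y : R * R),
          psi (y.1 + m.1%:~R, y.2 + m.2%:~R) =
          factor_K eps m * factor_L m y ^+ k * psi y &
        forall v y, nabla yc psi (J v) y = cI R * nabla yc psi v y]].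

End Hilbert.

(* A unital left module structure on a space [H] of functions over the algebra
   H^*(B, A_X^(k)), given on cocycles; any two classes are represented on a
   common cover. *)
Definition is_left_action (H : set (R * R -> C))
    (rho : cover -> cochain -> (R * R -> C) -> (R * R -> C)) : Prop :=
  [/\ forall cU c psi, is_open_cover cU -> is_cocycle cU c -> H psi ->
        H (rho cU c psi),
      forall cU c cV d psi, is_open_cover cU -> is_cocycle cU c ->
        is_open_cover cV -> is_cocycle cV d -> H psi ->
        cohomologous cU c cV d -> rho cU c psi = rho cV d psi,
      forall cU c (t : C) psi phi, is_open_cover cU -> is_cocycle cU c ->
        H psi -> H phi ->
        rho cU c (fun y => t * psi y + phi y) =
        (fun y => t * rho cU c psi y + rho cU c phi y),
      forall cU c d (t : C) psi, is_open_cover cU -> is_cocycle cU c ->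
        is_cocycle cU d -> H psi ->
        rho cU (fun sg U P => t * c sg U P + d sg U P) psi =
        (fun y => t * rho cU c psi y + rho cU d psi y) &
      forall cU psi, is_open_cover cU -> H psi ->
        rho cU cochain1 psi = psi /\
        forall c d, is_cocycle cU c -> is_cocycle cU d ->
          rho cU (cup c d) psi = rho cU c (rho cU d psi)].

End Level.
End Charts.
End Geometry.

(* Main.v *)
(* Only the sections over a neighbourhood of x matter: a cocycle of total degree
   acts through its degree 0 component on a member of the cover containing x,
   restricted to the fibre F_x = R^2/Z^2.  There it is a smooth function, whose
   Fourier coefficients [a_m] are absolutely summable, and the star product
   becomes the convolution of the families [a] twisted by [phase].  The twisted
   group algebra of Z^2 acts on the polarized sections by the Weyl operators
     T_m psi (y) = exp(-pi i m1 m2/(2k) - 2 pi i m2 y1) psi (y + m/(2k)),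
   which commute with the connection and satisfy T_m T_l = phase(m, l) T_(m+l),
   so that [a] acts as the sum of the a_m T_m.  By quasi-periodicity T_m depends
   on m only modulo 2k, up to a unit scalar, so this sum is a finite linear
   combination of Weyl operators and preserves the polarized sections. *)
From HB Require Import structures.
Require Import Defs.
From mathcomp Require Import ring lra zify.
Import Order.TTheory GRing.Theory Num.Theory.
Set Implicit Arguments.
Unset Strict Implicit.
Unset Printing Implicit Defensive.
Local Open Scope classical_set_scope.
Local Open Scope complex_scope.
Local Open Scope ring_scope.

(** * Absolutely summable families of real numbers *)


Section RealSums.
Variable R : realType.
Implicit Types (T S : choiceType) (c : R).

(** The origin of 2k: on the fibre, translation by h changes the connection of the k-th power of L
    by -4 pi i k h2 dy1. The gauge factor exp(-4 pi i k h2 y1) compensates this, and the automorphy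
    factors are then respected exactly when 2kh is integral. The radii |u| and |w| are constant on
    the fibre. They scale the Laurent coefficients of two factors inversely to the monomials of
    their product, so they cancel and only Fourier coefficients remain. The action descends to
    cohomology because degree 0 components on two members containing x agree on the intersection, by
    the cocycle condition, and because a coboundary has no degree 0 component. The analytic obstacle
    is that unordered infinite sums must be regrouped and integrated term by term. Both need
    absolute summability, hence a decay of Fourier coefficients like the product of the inverse
    squares of the nonzero frequencies; it is obtained from finite differences instead of
    integration by parts. Smoothness of the resulting section never requires differentiating an
    infinite sum, since the sum collapses over residues mod 2k. *)

Definition rsummable T (g : T -> R) := summable [set: T] (EFin \o g).

Lemma rsummable_le T (f g : T -> R) : rsummable g ->
  (forall t, `|f t| <= g t) -> rsummable f.
Proof.
move=> sg fg; apply: le_lt_trans sg; apply: le_esum => t _ /=.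
by rewrite lee_fin (le_trans (fg t)) // ler_norm.
Qed.

Lemma rsummableD T (f g : T -> R) : rsummable f -> rsummable g ->
  rsummable (fun t => f t + g t).
Proof. exact: summableD. Qed.

Lemma ge0_esumZ T c (f : T -> R) : 0 <= c -> (forall t, 0 <= f t) ->
  (\esum_(t in [set: T]) (c * f t)%:E = c%:E * \esum_(t in [set: T]) (f t)%:E)%E.
Proof.
move=> c0 f0; rewrite /esum -ereal_supZl //; last first.
  by apply/set0P; exists 0%E; exists set0; [split|rewrite fsbig_set0].
congr ereal_sup; apply/seteqP; split => [_ [A AT <-]|_ [_ [A AT <-] <-]].
  exists (\sum_(t \in A) (f t)%:E)%E; first by exists A.
  by rewrite ge0_mule_fsumr // => t; rewrite lee_fin.
by exists A => //; rewrite ge0_mule_fsumr // => t; rewrite lee_fin.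
Qed.

Lemma rsummableZ T c (f : T -> R) : rsummable f -> rsummable (fun t => c * f t).
Proof.
move=> sf; rewrite /rsummable /summable.
under eq_esum do rewrite /= normrM.
rewrite ge0_esumZ //; move: sf; rewrite /rsummable summableE /= => sf.
by rewrite -[X in (_ * X)%E]fineK // -EFinM ltry.
Qed.

Lemma ge0_rsummable_fin T (f : T -> R) : rsummable f -> (forall t, 0 <= f t) ->
  \esum_(t in [set: T]) (f t)%:E \is a fin_num.
Proof.
rewrite /rsummable summableE => sf f0.
rewrite [X in X \is a _](_ : _ = (\esum_(t in [set: T]) `|(f t)%:E|)%E) //.
by apply: eq_esum => t _; rewrite gee0_abs ?lee_fin.
Qed.

(** [rsum] is defined through positive and negative parts; this frees it from that decomposition, as
    any difference of nonnegative summable families will do. Additivity, scaling and Fubini all go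
    through it. *)
Lemma rsumB T (f g : T -> R) : rsummable f -> rsummable g ->
  (forall t, 0 <= f t) -> (forall t, 0 <= g t) ->
  rsum (fun t => f t - g t) =
  fine (\esum_(t in [set: T]) (f t)%:E) - fine (\esum_(t in [set: T]) (g t)%:E).
Proof.
move=> sf sg f0 g0; rewrite /rsum -fineB; try exact: ge0_rsummable_fin.
congr fine; rewrite -(esumB sf sg) /=; last 2 first.
- by move=> t _; rewrite lee_fin.
- by move=> t _; rewrite lee_fin.
by congr (_ - _)%E; apply: eq_esum => t _; rewrite ?funeposE ?funenegE /= -?EFinB -?EFinN EFin_max.
Qed.

Lemma maxr0_subN (r : R) : Num.max r 0 - Num.max (- r) 0 = r.
Proof.
by rewrite /Order.max oppr_lt0; case: ltgtP => [_|_|->];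
  rewrite ?subr0 ?sub0r ?opprK ?oppr0.
Qed.

Lemma maxr0_ge0 (r : R) : 0 <= Num.max r 0. Proof. by rewrite le_max lexx orbT. Qed.

Lemma maxr0_le_norm (r : R) : Num.max r 0 <= `|r|.
Proof. by rewrite ge_max ler_norm normr_ge0. Qed.

Lemma rsummable_pos T (g : T -> R) : rsummable g -> rsummable (fun t => Num.max (g t) 0).
Proof.
move=> sg; have sg' : rsummable (fun t => `|g t|).
  by rewrite /rsummable /summable; under eq_esum do rewrite /= normr_id.
by apply: rsummable_le sg' _ => t; rewrite ger0_norm ?maxr0_ge0 // maxr0_le_norm.
Qed.

Lemma rsummableN T (g : T -> R) : rsummable g -> rsummable (fun t => - g t).
Proof. by rewrite /rsummable (summableN _ (EFin \o g)). Qed.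

Lemma rsummable_norm T (g : T -> R) : rsummable g -> rsummable (fun t => `|g t|).
Proof.
by move=> sg; rewrite /rsummable /summable; under eq_esum do rewrite /= normr_id.
Qed.

Lemma rsumE T (g : T -> R) : rsummable g ->
  rsum g = fine (\esum_(t in [set: T]) (Num.max (g t) 0)%:E) -
           fine (\esum_(t in [set: T]) (Num.max (- g t) 0)%:E).
Proof.
move=> sg; rewrite -rsumB; try by move=> t; exact: maxr0_ge0.
- by congr rsum; apply/funext => t; rewrite maxr0_subN.
- exact: rsummable_pos.
- exact/rsummable_pos/rsummableN.
Qed.

Lemma fine_esumD T (f g : T -> R) : rsummable f -> rsummable g ->
  (forall t, 0 <= f t) -> (forall t, 0 <= g t) ->
  fine (\esum_(t in [set: T]) (f t + g t)%:E) =
  fine (\esum_(t in [set: T]) (f t)%:E) + fine (\esum_(t in [set: T]) (g t)%:E).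
Proof.
move=> sf sg f0 g0; rewrite -fineD; try exact: ge0_rsummable_fin.
congr fine; rewrite -esumD; try by move=> t _; rewrite lee_fin.
by apply: eq_esum => t _; rewrite EFinD.
Qed.

(** Positive parts do not add, so [f + g] is written as the sum of the positive parts minus the sum
    of the negative parts, a decomposition that [rsumB] accepts. *)
Lemma rsumD T (f g : T -> R) : rsummable f -> rsummable g ->
  rsum (fun t => f t + g t) = rsum f + rsum g.
Proof.
move=> sf sg.
have [sfp sgp] := (rsummable_pos sf, rsummable_pos sg).
have [sfn sgn] := (rsummable_pos (rsummableN sf), rsummable_pos (rsummableN sg)).
rewrite (rsumE sf) (rsumE sg) addrACA -opprD.
rewrite -!fine_esumD // => [|t|t|t|t]; try exact: maxr0_ge0.
rewrite -rsumB; [|exact: rsummableD|exact: rsummableD|by move=> t; rewrite addr_ge0 ?maxr0_ge0..].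
by congr rsum; apply/funext => t; rewrite opprD addrACA !maxr0_subN.
Qed.

Lemma rsumN T (g : T -> R) : rsummable g -> rsum (fun t => - g t) = - rsum g.
Proof.
move=> sg; rewrite (rsumE sg) (rsumE (rsummableN sg)) opprB; congr (_ - fine _).
by apply: eq_esum => t _; rewrite opprK.
Qed.

Lemma rsumZ T c (g : T -> R) : rsummable g -> rsum (fun t => c * g t) = c * rsum g.
Proof.
wlog c0 : c / 0 <= c => [H|] sg.
  have [/H|c0] := leP 0 c; first exact.
  rewrite -[RHS]opprK -mulNr -H ?oppr_ge0 1?ltW // -rsumN; last exact: rsummableZ.
  by congr rsum; apply/funext => t; rewrite mulNr opprK.
rewrite (rsumE sg) mulrBr; set x := fine _; set y := fine _.
(* No summability is asked of [f]: [fine] sends an infinite sum to 0, and both sides then vanish. *)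
have E (f : T -> R) : (forall t, 0 <= f t) ->
    c * fine (\esum_(t in [set: T]) (f t)%:E) = fine (\esum_(t in [set: T]) (c * f t)%:E).
  move=> f0; rewrite ge0_esumZ //; case: (\esum_(t in [set: T]) (f t)%:E) => [r||] //=.
    by rewrite mulr0; case: ltgtP c0 => // [c0|<-] _; rewrite ?mul0e // gt0_muley.
  by rewrite mulr0; case: ltgtP c0 => // [c0|<-] _; rewrite ?mul0e // gt0_muleNy.
rewrite /x /y !E; try by move=> t; exact: maxr0_ge0.
rewrite -rsumB; try by move=> t; rewrite mulr_ge0 ?maxr0_ge0.
- by congr rsum; apply/funext => t; rewrite -mulrBr maxr0_subN.
- exact/rsummableZ/rsummable_pos.
- exact/rsummableZ/rsummable_pos/rsummableN.
Qed.

(** The positive and the negative part of [f] each sum to a value between 0 and [rsum g], which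
    bounds their difference. *)
Lemma rsum_le T (f g : T -> R) : rsummable g -> (forall t, `|f t| <= g t) ->
  `|rsum f| <= rsum g.
Proof.
move=> sg fg; have sf := rsummable_le sg fg.
have g0 t : 0 <= g t by exact: le_trans (fg t).
have le0 (h : T -> R) : (forall t, `|h t| <= g t) -> rsummable h ->
    0 <= fine (\esum_(t in [set: T]) (Num.max (h t) 0)%:E) <= rsum g.
  move=> hg sh; rewrite fine_ge0 /=; last by apply: esum_ge0 => t _; rewrite lee_fin maxr0_ge0.
  have -> : rsum g = fine (\esum_(t in [set: T]) (g t)%:E).
    rewrite (rsumE sg) [X in _ - fine X]esum1 ?subr0 /=; last first.
      by move=> t _; rewrite max_r // oppr_le0.
    by congr fine; apply: eq_esum => t _; rewrite max_l.
  apply: fine_le; last 1 first.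
  - by apply: le_esum => t _; rewrite lee_fin (le_trans (maxr0_le_norm _)).
  - exact: ge0_rsummable_fin (rsummable_pos sh) (fun=> maxr0_ge0 _).
  - exact: ge0_rsummable_fin.
have /andP[a0 a1] := le0 _ fg sf.
have /andP[b0 b1] : 0 <= fine (\esum_(t in [set: T]) (Num.max (- f t) 0)%:E) <= rsum g.
  by apply: le0 (rsummableN sf) => t; rewrite normrN.
rewrite (rsumE sf) ler_norml; apply/andP; split.
  by rewrite lerBrDr (le_trans _ a0) // addrC subr_le0.
by rewrite lerBlDr (le_trans a1) // lerDl.
Qed.

Lemma rsum_reindex T S (e : T -> S) (g : S -> R) : bijective e ->
  rsum g = rsum (g \o e).
Proof.
move=> be; have be' : set_bij [set: T] [set: S] e.
  split => //; first by move=> x y _ _; exact: bij_inj.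
  by case: be => e' _ e'K y _; exists (e' y).
by rewrite /rsum !(reindex_esum [set: T] [set: S] e).
Qed.

Lemma rsummable_reindex T S (e : T -> S) (g : S -> R) : bijective e ->
  rsummable g -> rsummable (g \o e).
Proof.
move=> be; have be' : set_bij [set: T] [set: S] e.
  split => //; first by move=> x y _ _; exact: bij_inj.
  by case: be => e' _ e'K y _; exists (e' y).
by rewrite /rsummable /summable (reindex_esum [set: T] [set: S] e).
Qed.

Lemma ge0_esum_pair T S (g : T * S -> \bar R) : (forall p, (0 <= g p)%E) ->
  \esum_(p in [set: T * S]) g p =
  \esum_(t in [set: T]) \esum_(s in [set: S]) g (t, s).
Proof.
move=> g0; rewrite (@esum_esum _ _ _ setT (fun=> setT) (fun t s => g (t, s))) //.
rewrite (_ : setT `*`` (fun=> setT) = setT); last by apply/seteqP; split.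
by apply: eq_esum => -[].
Qed.

Lemma rsummable_section T S (g : T * S -> R) (t : T) : rsummable g ->
  rsummable (fun s => g (t, s)).
Proof.
rewrite /rsummable /summable; apply: le_lt_trans.
rewrite ge0_esum_pair //.
by apply: esum_ge; exists [set t]; [split => //; exact: finite_set1|rewrite fsbig_set1].
Qed.

Lemma ge0_fine_esum_pair T S (g : T * S -> R) : rsummable g -> (forall p, 0 <= g p) ->
  rsummable (fun t => fine (\esum_(s in [set: S]) (g (t, s))%:E)) /\
  fine (\esum_(p in [set: T * S]) (g p)%:E) =
  fine (\esum_(t in [set: T]) (fine (\esum_(s in [set: S]) (g (t, s))%:E))%:E).
Proof.
move=> sg g0.
have E : \esum_(p in [set: T * S]) (g p)%:E =
    \esum_(t in [set: T]) (fine (\esum_(s in [set: S]) (g (t, s))%:E))%:E.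
  rewrite ge0_esum_pair; last by move=> p; rewrite lee_fin.
  by apply: eq_esum => t _; rewrite fineK //;
    apply: ge0_rsummable_fin => //; exact: rsummable_section.
split; last by rewrite E.
rewrite /rsummable summableE.
under eq_esum => t _.
  rewrite gee0_abs /=; last by rewrite lee_fin fine_ge0 // esum_ge0 // => s _; rewrite lee_fin.
  over.
by rewrite -E; exact: ge0_rsummable_fin.
Qed.

(** Tonelli for the positive and negative parts separately. The two families of inner sums need not
    be the positive and negative parts of their difference, which is why [rsumB] recombines them. *)
Lemma rsum_pair T S (g : T * S -> R) : rsummable g ->
  rsummable (fun t => rsum (fun s => g (t, s))) /\
  rsum g = rsum (fun t => rsum (fun s => g (t, s))).
Proof.
move=> sg.
have [sp Ep] := ge0_fine_esum_pair (rsummable_pos sg) (fun=> maxr0_ge0 _).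
have [sn En] := ge0_fine_esum_pair (rsummable_pos (rsummableN sg)) (fun=> maxr0_ge0 _).
have E t : rsum (fun s => g (t, s)) = fine (\esum_(s in [set: S]) (Num.max (g (t, s)) 0)%:E)
    - fine (\esum_(s in [set: S]) (Num.max (- g (t, s)) 0)%:E).
  exact/rsumE/rsummable_section.
under eq_fun do rewrite E; split.
  exact: rsummableD sp (rsummableN sn).
rewrite rsumB //; last 2 first.
- by move=> t; rewrite fine_ge0 // esum_ge0 // => s _; rewrite lee_fin maxr0_ge0.
- by move=> t; rewrite fine_ge0 // esum_ge0 // => s _; rewrite lee_fin maxr0_ge0.
by rewrite (rsumE sg) Ep En.
Qed.

Lemma esum_delta T (t0 : T) c : 0 <= c ->
  \esum_(t in [set: T]) (if t == t0 then c else 0)%:E = c%:E.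
Proof.
move=> c0; rewrite -(@esum_set1 _ _ t0 (fun=> c%:E)) // [RHS]esum_mkcond.
apply: eq_esum => t _ /=; have [->|tt0] := eqVneq t t0.
  by rewrite ifT // inE.
by rewrite ifF //; apply/negbTE; rewrite notin_setE; apply/eqP.
Qed.

Lemma rsummable_delta T (t0 : T) c : rsummable (fun t => if t == t0 then c else 0).
Proof.
rewrite /rsummable /summable (_ : (fun t => _) = fun t => (if t == t0 then `|c| else 0)%:E).
  by rewrite esum_delta // ltry.
by apply/funext => t /=; case: eqP; rewrite ?normr0.
Qed.

Lemma rsum_delta T (t0 : T) c : rsum (fun t => if t == t0 then c else 0) = c.
Proof.
rewrite rsumE; last exact: rsummable_delta.
rewrite (_ : (fun t => (Num.max (if t == t0 then c else 0) 0)%:E) =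
    fun t => (if t == t0 then Num.max c 0 else 0)%:E); last first.
  by apply/funext => t; case: eqP; rewrite // maxxx.
rewrite (_ : (fun t => (Num.max (- (if t == t0 then c else 0)) 0)%:E) =
    fun t => (if t == t0 then Num.max (- c) 0 else 0)%:E); last first.
  by apply/funext => t; case: eqP; rewrite // oppr0 maxxx.
by rewrite !esum_delta ?maxr0_ge0 //= maxr0_subN.
Qed.

Lemma rsum_seqE T (g : T -> R) (F : seq T) : uniq F ->
  rsummable (fun t => if t \in F then g t else 0) /\
  rsum (fun t => if t \in F then g t else 0) = \sum_(t <- F) g t.
Proof.
elim: F => [_|t0 F IH /= /andP[t0F uF]].
  have s0 : rsummable (fun _ : T => 0 : R).
    by rewrite /rsummable /summable esum1 ?ltry // => t _; rewrite /= normr0.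
  rewrite big_nil; split => //; have := rsumZ 0 s0.
  by under eq_fun do rewrite mul0r; rewrite mul0r.
have [sF EF] := IH uF.
have E : (fun t => if t \in t0 :: F then g t else 0) =
    fun t => (if t == t0 then g t0 else 0) + (if t \in F then g t else 0).
  apply/funext => t; rewrite inE; have [->|] //= := eqVneq t t0.
    by rewrite (negbTE t0F) addr0.
  by rewrite add0r.
rewrite E; split; first exact: rsummableD (rsummable_delta _ _) sF.
by rewrite rsumD ?rsum_delta ?EF ?big_cons //; exact: rsummable_delta.
Qed.

(** The sum is a supremum over finite subsets, so a nearly optimal subset leaves a tail of at most
    [e]. *)
Lemma rsummable_tail T (g : T -> R) e : rsummable g -> (forall t, 0 <= g t) -> 0 < e ->
  exists F : seq T, uniq F /\
    rsum (fun t => if t \in F then 0 else g t) <= e.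
Proof.
move=> sg g0 e0; have gfin := ge0_rsummable_fin sg g0.
have [_ [A [finA _] <-] /ltW Ae] := ub_ereal_sup_adherent e0 gfin.
set F := finmap.enum_fset (fset_set A).
have uF : uniq F by exact: finmap.fset_uniq.
exists F; split => //; have [sF EF] := rsum_seqE g uF.
have st : rsummable (fun t => if t \in F then 0 else g t).
  by apply: rsummable_le sg _ => t; case: ifP; rewrite ?normr0 ?ger0_norm.
have : rsum g = rsum (fun t => if t \in F then g t else 0) +
   rsum (fun t => if t \in F then 0 else g t).
  by rewrite -rsumD //; congr rsum; apply/funext => t; case: ifP; rewrite ?addr0 ?add0r.
rewrite EF => /eqP; rewrite addrC -subr_eq => /eqP <-.
have -> : rsum g = fine (\esum_(t in [set: T]) (g t)%:E).
  rewrite (rsumE sg) [X in _ - fine X]esum1 ?subr0 /=; last first.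
    by move=> t _; rewrite max_r // oppr_le0.
  by congr fine; apply: eq_esum => t _; rewrite max_l.
move: Ae; rewrite fsbig_finite //= sumEFin -[ereal_sup _]fineK // -EFinB lee_fin.
by rewrite lerBlDr lerBlDl addrC.
Qed.

End RealSums.

(** * Integration over the torus *)


Section TorusIntegral.
Variable R : realType.
Local Notation mu := (@lebesgue_measure R).
Implicit Types (F : R -> R) (g : R * R -> R).

Lemma continuous_itv_integrable F (a b : R) : continuous F ->
  mu.-integrable `[a, b] (EFin \o F).
Proof.
move=> cF; apply: continuous_compact_integrable; first exact: segment_compact.
exact: continuous_subspaceT.
Qed.

Lemma Rintegral_shift F (a b h : R) : a <= b -> continuous F ->
  \int[mu]_(s in `[a, b]) F (s + h) = \int[mu]_(s in `[a + h, b + h]) F s.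
Proof.
move=> ab cF; rewrite /Rintegral; congr fine.
have dh : derive1 (fun s : R => s + h) = cst 1.
  by apply/funext => s; rewrite derive1E derive_val addr0.
have ch : continuous (fun s : R => s + h) by move=> s; apply: cvgD; [exact: cvg_id|exact: cvg_cst].
rewrite (@integration_by_substitution_increasing _ (fun s => s + h) F) //.
- by apply: eq_integral => s _; rewrite dh /= mulr1.
- by move=> u v _ _; rewrite ltrD2r.
- by rewrite dh => u _; exact: cvg_cst.
- by rewrite dh; exact: is_cvg_cst.
- by rewrite dh; exact: is_cvg_cst.
- split.
  + by move=> u _; apply: derivableD => //.
  + exact/cvg_at_right_filter/ch.
  + exact/cvg_at_left_filter/ch.
- exact: continuous_subspaceT.
Qed.

Lemma Rintegral_cat F (a b c : R) : a <= b -> b <= c -> continuous F ->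
  \int[mu]_(s in `[a, c]) F s =
  \int[mu]_(s in `[a, b]) F s + \int[mu]_(s in `[b, c]) F s.
Proof.
move=> ab bc cF.
have := @Rintegral_itvB R F (BLeft a) (BRight c) b (continuous_itv_integrable _ _ cF).
rewrite !bnd_simp => /(_ ab bc) /eqP; rewrite subr_eq addrC => /eqP ->.
congr (_ + _); rewrite Rintegral_itv_obnd_cbnd //.
apply: integrableS (continuous_itv_integrable b c cF) => //.
exact: subset_itv_oc_cc.
Qed.

(** The interval [h, 1 + h] is cut at 1, and periodicity moves [1, 1 + h] back onto [0, h]. *)
Lemma Rintegral_periodic_shift F (h : R) : 0 <= h <= 1 -> continuous F ->
  (forall s, F (s + 1) = F s) ->
  \int[mu]_(s in `[0, 1]) F (s + h) = \int[mu]_(s in `[0, 1]) F s.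
Proof.
move=> /andP[h0 h1] cF pF; rewrite Rintegral_shift // add0r.
rewrite (@Rintegral_cat _ h 1 (1 + h)) // ?lerDl //.
rewrite addrC (@Rintegral_cat _ 0 h 1) //; congr (_ + _).
rewrite -{1}[1]add0r [1 + h]addrC -Rintegral_shift //.
by apply: eq_Rintegral => s _; rewrite pF.
Qed.

Lemma Rintegral01_bound F (M : R) : continuous F -> (forall s, `|F s| <= M) ->
  `|\int[mu]_(s in `[0, 1]) F s| <= M.
Proof.
move=> cF FM; apply: (le_trans (le_normr_Rintegral _ _)) => //.
  exact: continuous_itv_integrable.
have cst1 : \int[mu]_(s in `[0, 1]) M = M.
  by rewrite Rintegral_cst //= lebesgue_measure_itv /= lte01 oppr0 adde0 mulr1.
rewrite -[leRHS]cst1; apply: le_Rintegral => //.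
  apply: (@continuous_itv_integrable (fun s => `|F s|)) => s.
  exact: (@continuous_comp _ _ _ F Num.norm s (cF s) (@norm_continuous _ _ _)).
apply: (@continuous_itv_integrable (fun=> M)) => s; exact: cvg_cst.
Qed.

Lemma continuous_sectionl g (s : R) : continuous g -> continuous (fun t => g (s, t)).
Proof.
by move=> cg t; apply: (@continuous_comp _ _ _ (fun t => (s, t)) g);
  [exact: (@cvg_pair _ _ _ (nbhs t) (nbhs s) (nbhs t) _ _ _ _ _ (cvg_cst s) cvg_id)|exact: cg].
Qed.

Lemma continuous_sectionr g (t : R) : continuous g -> continuous (fun s => g (s, t)).
Proof.
by move=> cg s; apply: (@continuous_comp _ _ _ (fun s => (s, t)) g);
  [exact: (@cvg_pair _ _ _ (nbhs s) (nbhs s) (nbhs t) _ _ _ _ _ cvg_id (cvg_cst t))|exact: cg].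
Qed.

Lemma continuous_rectangle_bounded g (a b c d : R) : continuous g ->
  exists M, forall s t, a <= s <= b -> c <= t <= d -> `|g (s, t)| <= M.
Proof.
move=> cg.
have cK : compact (`[a, b] `*` `[c, d] : set (R * R)).
  by apply: compact_setX; exact: segment_compact.
have := continuous_compact (continuous_subspaceT cg) cK.
move=> /compact_bounded [M [_ /(_ (M + 1))]]; rewrite ltrDl ltr01 => /(_ erefl) H.
exists (M + 1) => s t st tt; apply: H; exists (s, t) => //; split; rewrite /= in_itv.

Qed.

(** Continuity under the integral sign near [s0], dominated by the maximum over the compact
    rectangle [s0 - 1, s0 + 1] x [0, 1]. *)
Lemma continuous_inner_integral g : continuous g ->
  continuous (fun s => \int[mu]_(t in `[0, 1]) g (s, t)).
Proof.
move=> cg s0.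
have [M gM] := @continuous_rectangle_bounded g (s0 - 1) (s0 + 1) 0 1 cg.
have Is : s0 \in `]s0 - 1, s0 + 1[%classic.
  by rewrite inE /= in_itv /= ltrBlDr ltrDl ltr01.
have lem := @continuity_under_integral R _ _ mu (fun s t => g (s, t))
  `[0, 1]%classic (measurable_itv _) (s0 - 1) (s0 + 1) _ _ (fun=> M) _ _ s0 Is.
apply: lem.
- by move=> s _; apply: continuous_itv_integrable; exact: continuous_sectionl.
- by apply: aeW => t _ s _; exact: continuous_sectionr.
- by apply: continuous_itv_integrable => s; exact: cvg_cst.
- move=> s /=; rewrite in_itv /= => /andP[s1 s2]; apply: aeW => t; rewrite /= in_itv /= => t01.
  by apply: gM => //; rewrite (ltW s1) (ltW s2).
Qed.

Lemma rint2D g g' : continuous g -> continuous g' ->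
  rint2 (fun y => g y + g' y) = rint2 g + rint2 g'.
Proof.
move=> cg cg'; rewrite /rint2 -RintegralD //.
- apply: eq_Rintegral => s _; rewrite RintegralD //;
  by apply: continuous_itv_integrable; exact: continuous_sectionl.
- exact: continuous_itv_integrable (continuous_inner_integral cg).
- exact: continuous_itv_integrable (continuous_inner_integral cg').
Qed.

Lemma rint2Z (c : R) g : continuous g ->
  rint2 (fun y => c * g y) = c * rint2 g.
Proof.
move=> cg; rewrite /rint2 -RintegralZl //.
- apply: eq_Rintegral => s _; rewrite RintegralZl //.
  by apply: continuous_itv_integrable; exact: continuous_sectionl.
- exact: continuous_itv_integrable (continuous_inner_integral cg).
Qed.

Lemma rint2_cst (c : R) : rint2 (fun=> c) = c.
Proof.
have cst1 d : \int[mu]_(s in `[0, 1]) d = d.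
  by rewrite Rintegral_cst //= lebesgue_measure_itv /= lte01 oppr0 adde0 mulr1.
by rewrite /rint2 !cst1.
Qed.

Lemma rint2_bound g (M : R) : continuous g -> (forall y, `|g y| <= M) ->
  `|rint2 g| <= M.
Proof.
move=> cg gM; apply: Rintegral01_bound (continuous_inner_integral cg) _ => s.
by apply: Rintegral01_bound => //; exact: continuous_sectionl.
Qed.

Definition periodic (T : Type) (g : R * R -> T) :=
  forall (m : int * int) y, g (y.1 + m.1%:~R, y.2 + m.2%:~R) = g y.

Lemma rint2_shift1 g (h : R) : 0 <= h <= 1 -> continuous g -> periodic g ->
  rint2 (fun y => g (y.1 + h, y.2)) = rint2 g.
Proof.
move=> h01 cg pg; rewrite /rint2.
apply: (Rintegral_periodic_shift h01 (continuous_inner_integral cg)) => s.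
by apply: eq_Rintegral => t _; rewrite -[RHS](pg (1, 0)) /= addr0.
Qed.

Lemma rint2_shift2 g (h : R) : 0 <= h <= 1 -> continuous g -> periodic g ->
  rint2 (fun y => g (y.1, y.2 + h)) = rint2 g.
Proof.
move=> h01 cg pg; rewrite /rint2; apply: eq_Rintegral => s _.
apply: (etrans _ (Rintegral_periodic_shift h01 (continuous_sectionl (s := s) cg) _)) => // t.
by rewrite -[RHS](pg (0, 1)) /= addr0.
Qed.

Lemma periodic_bounded g : continuous g -> periodic g ->
  exists M, forall y, `|g y| <= M.
Proof.
move=> cg pg; have [M gM] := @continuous_rectangle_bounded g 0 1 0 1 cg.
(* Subtracting the integer parts moves [y] into the unit square, where compactness gives the
   bound. *)
exists M => y; rewrite -(pg (- Num.floor y.1, - Num.floor y.2)) /=.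
have H (r : R) : 0 <= r + (- Num.floor r)%:~R <= 1.
  by rewrite rmorphN /= subr_ge0 ge_floor lerBlDl -intrD1 ltW // floorD1_gt.
exact: gM.
Qed.

End TorusIntegral.

(** * Complex numbers, complex families and complex integrals *)


Section ComplexNumbers.
Variable R : realType.
Implicit Types z w : R[i].

Lemma complexP z w : complex.Re z = complex.Re w -> complex.Im z = complex.Im w -> z = w.
Proof. by case: z w => [? ?] [? ?] /= -> ->. Qed.

Lemma Re_addc z w : complex.Re (z + w) = complex.Re z + complex.Re w.
Proof. by case: z w => [? ?] [? ?]. Qed.
Lemma Im_addc z w : complex.Im (z + w) = complex.Im z + complex.Im w.
Proof. by case: z w => [? ?] [? ?]. Qed.
Lemma Re_oppc z : complex.Re (- z) = - complex.Re z. Proof. by case: z. Qed.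
Lemma Im_oppc z : complex.Im (- z) = - complex.Im z. Proof. by case: z. Qed.
Lemma Re_mulc z w : complex.Re (z * w) =
  complex.Re z * complex.Re w - complex.Im z * complex.Im w.
Proof. by case: z w => [? ?] [? ?]. Qed.
Lemma Im_mulc z w : complex.Im (z * w) =
  complex.Re z * complex.Im w + complex.Im z * complex.Re w.
Proof. by case: z w => [? ?] [? ?]. Qed.

Lemma normc_ge0 z : 0 <= Normc.normc z.
Proof. by case: z => a b; rewrite sqrtr_ge0. Qed.

Lemma Re_le_normc z : `|complex.Re z| <= Normc.normc z.
Proof. by case: z => a b /=; rewrite -sqrtr_sqr ler_sqrt ?lerDl ?sqr_ge0 ?addr_ge0 ?sqr_ge0. Qed.

Lemma Im_le_normc z : `|complex.Im z| <= Normc.normc z.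
Proof. by case: z => a b /=; rewrite -sqrtr_sqr ler_sqrt ?lerDr ?sqr_ge0 ?addr_ge0 ?sqr_ge0. Qed.

Lemma normc_le z : Normc.normc z <= `|complex.Re z| + `|complex.Im z|.
Proof.
case: z => a b /=; rewrite -[leRHS]ger0_norm ?addr_ge0 // -sqrtr_sqr ler_sqrt ?sqr_ge0 //.
by rewrite sqrrD !real_normK ?num_real // lerD2r lerDl mulrn_wge0 ?mulr_ge0.
Qed.

Definition cis (t : R) : R[i] := cos t +i* sin t.

Lemma cisD s t : cis (s + t) = cis s * cis t.
Proof. by apply: complexP; rewrite ?Re_mulc ?Im_mulc /= ?cosD ?sinD //; rewrite addrC. Qed.

Lemma cis0 : cis 0 = 1. Proof. by rewrite /cis cos0 sin0. Qed.

Lemma cispi : cis pi = - 1. Proof. by apply: complexP; rewrite /= ?cospi ?sinpi ?oppr0. Qed.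

Lemma cisNpi : cis (- pi) = - 1.
Proof. by apply: complexP; rewrite /= ?cosN ?sinN ?cospi ?sinpi ?oppr0. Qed.

Lemma cis_unit t : cis t \is a GRing.unit.
Proof. by apply/unitrP; exists (cis (- t)); rewrite -!cisD addrN addNr cis0. Qed.

Lemma cisN t : cis (- t) = (cis t)^-1.
Proof. by apply: (mulrI (cis_unit t)); rewrite -cisD addrN cis0 divrr ?cis_unit. Qed.

Lemma cis_int t (m : int) : cis (t *~ m) = cis t ^ m.
Proof.
have nat (k : nat) : cis (t *+ k) = cis t ^+ k.
  by elim: k => [|k IH]; rewrite ?mulr0n ?cis0 ?expr0 // mulrS cisD IH exprS.
case: m => k; first by rewrite -pmulrn nat.
by rewrite NegzE mulrNz cisN -pmulrn nat -exprnN.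
Qed.

Lemma cis2pi (m : int) : cis (2 * pi * m%:~R) = 1.
Proof.
by rewrite mulrzr cis_int mulr_natl mulr2n cisD cispi mulrNN mulr1 exp1rz.
Qed.

Lemma normc_cis t : Normc.normc (cis t) = 1.
Proof. by rewrite /= cos2Dsin2 sqrtr1. Qed.

Lemma cexpE (a b : R) : cexp (a +i* b) = (expR a)%:C * cis b.
Proof. by []. Qed.

Lemma cexpD z w : cexp (z + w) = cexp z * cexp w.
Proof.
by rewrite /cexp Re_addc Im_addc expRD rmorphM -!/(cis _) cisD mulrACA.
Qed.

Lemma cexp_unit z : cexp z \is a GRing.unit.
Proof.
apply/unitrP; exists (cexp (- z)); rewrite -!cexpD addrN addNr.
by rewrite /cexp /= expR0 -/(cis 0) cis0 mulr1.
Qed.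

Lemma cexp0 : cexp 0 = 1 :> R[i].
Proof. by rewrite /cexp /= expR0 -/(cis 0) cis0 mulr1. Qed.

Lemma cexpN z : cexp (- z) = (cexp z)^-1.
Proof. by apply: (mulrI (cexp_unit z)); rewrite -cexpD addrN cexp0 divrr ?cexp_unit. Qed.

Lemma cexp_int z (m : int) : cexp (z *~ m) = cexp z ^ m.
Proof.
have nat (k : nat) : cexp (z *+ k) = cexp z ^+ k.
  by elim: k => [|k IH]; rewrite ?mulr0n ?cexp0 ?expr0 // mulrS cexpD IH exprS.
case: m => k; first by rewrite -pmulrn nat.
by rewrite NegzE mulrNz cexpN -pmulrn nat -exprnN.
Qed.

End ComplexNumbers.

Section ComplexSums.
Variable R : realType.
Implicit Types (T S : choiceType) (z : R[i]).

Definition csummable T (g : T -> R[i]) := rsummable (fun t => Normc.normc (g t)).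

Lemma csummable_le T (b : T -> R) (g : T -> R[i]) : rsummable b ->
  (forall t, Normc.normc (g t) <= b t) -> csummable g.
Proof.
by move=> sb gb; apply: rsummable_le sb _ => t; rewrite ger0_norm ?normc_ge0.
Qed.

Lemma csummable_Re T (g : T -> R[i]) : csummable g -> rsummable (fun t => complex.Re (g t)).
Proof. by move=> sg; apply: rsummable_le sg _ => t; exact: Re_le_normc. Qed.

Lemma csummable_Im T (g : T -> R[i]) : csummable g -> rsummable (fun t => complex.Im (g t)).
Proof. by move=> sg; apply: rsummable_le sg _ => t; exact: Im_le_normc. Qed.

Lemma csummable_ReIm T (g : T -> R[i]) : rsummable (fun t => complex.Re (g t)) ->
  rsummable (fun t => complex.Im (g t)) -> csummable g.
Proof.
move=> /rsummable_norm sr /rsummable_norm si.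
by apply: csummable_le (rsummableD sr si) _ => t; exact: normc_le.
Qed.

Lemma csummableD T (f g : T -> R[i]) : csummable f -> csummable g ->
  csummable (fun t => f t + g t).
Proof.
by move=> sf sg; apply: csummable_le (rsummableD sf sg) _ => t; exact: le_normcD.
Qed.

Lemma csummableM T (b f : T -> R[i]) (M : R) : csummable f ->
  (forall t, Normc.normc (b t) <= M) -> csummable (fun t => b t * f t).
Proof.
move=> sf bM; apply: csummable_le (rsummableZ M sf) _ => t.
by rewrite Normc.normcM ler_wpM2r ?normc_ge0.
Qed.

Lemma csummableZ T z (f : T -> R[i]) : csummable f -> csummable (fun t => z * f t).
Proof. by move=> sf; apply: (csummableM sf (M := Normc.normc z)). Qed.

Lemma csumD T (f g : T -> R[i]) : csummable f -> csummable g ->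
  csum (fun t => f t + g t) = csum f + csum g.
Proof.
move=> sf sg; apply: complexP; rewrite ?Re_addc ?Im_addc /=.
  rewrite -rsumD; [|exact: csummable_Re..].
  by congr rsum; apply/funext => t; rewrite Re_addc.
rewrite -rsumD; [|exact: csummable_Im..].
by congr rsum; apply/funext => t; rewrite Im_addc.
Qed.

Lemma csumZ T z (f : T -> R[i]) : csummable f -> csum (fun t => z * f t) = z * csum f.
Proof.
move=> sf; have [sr si] := (csummable_Re sf, csummable_Im sf).
apply: complexP; rewrite ?Re_mulc ?Im_mulc /=; rewrite -!rsumZ //.
  rewrite -rsumN; last exact: rsummableZ.
  rewrite -rsumD; [|exact: rsummableZ|exact/rsummableN/rsummableZ].
  by congr rsum; apply/funext => t; rewrite Re_mulc.
rewrite -rsumD; [|exact: rsummableZ..].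
by congr rsum; apply/funext => t; rewrite Im_mulc.
Qed.

Lemma csummable0 T : csummable (fun _ : T => 0 : R[i]).
Proof.
rewrite /csummable; under eq_fun do rewrite Normc.normc0.
by have [+ _] := rsum_seqE (fun _ : T => 0 : R) (isT : uniq [::]).
Qed.

Lemma csum0 T : csum (fun _ : T => 0) = 0 :> R[i].
Proof.
rewrite -[RHS](mul0r (csum (fun _ : T => 0))) -csumZ; last exact: csummable0.
by congr csum; apply/funext => t; rewrite mul0r.
Qed.

Lemma csummable_sum T (I : Type) (r : seq I) (f : I -> T -> R[i]) :
  (forall i, csummable (f i)) -> csummable (fun t => \sum_(i <- r) f i t).
Proof.
move=> sf; elim: r => [|i r IH].
  by under eq_fun do rewrite big_nil; exact: csummable0.
by under eq_fun do rewrite big_cons; exact: csummableD.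
Qed.

Lemma csum_sum T (I : Type) (r : seq I) (f : I -> T -> R[i]) :
  (forall i, csummable (f i)) ->
  csum (fun t => \sum_(i <- r) f i t) = \sum_(i <- r) csum (f i).
Proof.
move=> sf; elim: r => [|i r IH].
  by under eq_fun do rewrite big_nil; rewrite csum0 big_nil.
under eq_fun do rewrite big_cons.
by rewrite csumD ?IH ?big_cons //; exact: csummable_sum.
Qed.

Lemma csum_delta T (t0 : T) z : csum (fun t => if t == t0 then z else 0) = z.
Proof.
apply: complexP => /=; rewrite -[RHS](rsum_delta t0); congr rsum;
  by apply/funext => t; case: eqP.
Qed.

Lemma csum_reindex T S (e : T -> S) (g : S -> R[i]) : bijective e ->
  csum g = csum (g \o e).
Proof. by move=> be; apply: complexP; rewrite /= (rsum_reindex _ be). Qed.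

Lemma csummable_reindex T S (e : T -> S) (g : S -> R[i]) : bijective e ->
  csummable g -> csummable (g \o e).
Proof. by move=> be; exact: rsummable_reindex. Qed.

Lemma csum_pair T S (g : T * S -> R[i]) : csummable g ->
  csummable (fun t => csum (fun s => g (t, s))) /\
  csum g = csum (fun t => csum (fun s => g (t, s))).
Proof.
move=> sg.
have [sr Er] := rsum_pair (csummable_Re sg).
have [si Ei] := rsum_pair (csummable_Im sg).
by split; [exact: csummable_ReIm|apply: complexP; rewrite /= ?Er ?Ei].
Qed.

Lemma rsummable_prod T S (f : T -> R) (g : S -> R) :
  rsummable f -> rsummable g -> rsummable (fun p : T * S => f p.1 * g p.2).
Proof.
move=> sf sg; rewrite /rsummable /summable ge0_esum_pair //=.
under eq_esum => t _.
  under eq_esum do rewrite normrM.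
  rewrite ge0_esumZ // -[X in (_ * X)%E]fineK; last first.
    by apply: ge0_rsummable_fin => //; exact: rsummable_norm.
  rewrite -EFinM mulrC.
  over.
have := rsummableZ (fine (\esum_(i in [set: S]) `|g i|%:E)) (rsummable_norm sf).
by apply: le_lt_trans; apply: le_esum => t _; rewrite lee_fin ler_norm.
Qed.

Lemma csummable_prod T S (f : T -> R[i]) (g : S -> R[i]) :
  csummable f -> csummable g -> csummable (fun p : T * S => f p.1 * g p.2).
Proof.
move=> sf sg; apply: csummable_le (rsummable_prod sf sg) _ => p.
by rewrite Normc.normcM.
Qed.

End ComplexSums.

(** * Termwise integration of dominated families over the torus *)

Section TorusComplex.
Variable R : realType.
Local Notation C := R[i].
Implicit Types (g : R * R -> R) (f : R * R -> C).

Lemma continuous_of_uniform_approx g :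
  (forall e, 0 < e -> exists p : R * R -> R, continuous p /\ forall y, `|g y - p y| <= e) ->
  continuous g.
Proof.
move=> H y0; apply/cvgrPdist_lt => e e0.
have [p [cp gp]] := H (e / 3) (divr_gt0 e0 (ltr0n _ 3)).
have /cvgrPdist_lt/(_ (e / 3) (divr_gt0 e0 (ltr0n _ 3))) := cp y0.
apply: filterS => y py.
rewrite (_ : g y0 - g y = (g y0 - p y0) + (p y0 - p y) + (p y - g y)); last first.
  by ring.
rewrite (le_lt_trans (ler_normD _ _)) // (_ : e = e / 3 + e / 3 + e / 3); last by field.
rewrite ltr_leD //; last by rewrite distrC.
by rewrite (le_lt_trans (ler_normD _ _)) // ler_ltD.
Qed.

Lemma rint2_sum (T : Type) (r : seq T) (F : T -> R * R -> R) :
  (forall t, continuous (F t)) ->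
  continuous (fun y => \sum_(t <- r) F t y) /\
  rint2 (fun y => \sum_(t <- r) F t y) = \sum_(t <- r) rint2 (F t).
Proof.
move=> cF; elim: r => [|t r [cr Er]].
  under eq_fun do rewrite big_nil; rewrite big_nil rint2_cst.
  by split => // y; exact: cvg_cst.
under eq_fun do rewrite big_cons; rewrite big_cons.
split; first by move=> y; apply: cvgD; [exact: cF|exact: cr].
by rewrite rint2D ?Er.
Qed.

(** Finite partial sums approximate uniformly in [y]. This yields continuity as a uniform limit, and
    bounds the difference of the two sides by any positive [e]. *)
Lemma rint2_rsum (T : choiceType) (b : T -> R) (F : T -> R * R -> R) :
  rsummable b -> (forall t, continuous (F t)) -> (forall t y, `|F t y| <= b t) ->
  continuous (fun y => rsum (fun t => F t y)) /\
  rint2 (fun y => rsum (fun t => F t y)) = rsum (fun t => rint2 (F t)).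
Proof.
move=> sb cF Fb.
have b0 t : 0 <= b t by exact: le_trans (Fb t 0).
(* The finite list [r] depends only on [b] and [e], so it serves at once for the families [F t y] at
   all points [y] and for the family of integrals [rint2 (F t)]. *)
have tail e : 0 < e -> exists r : seq T, forall h : T -> R,
    (forall t, `|h t| <= b t) -> `|rsum h - \sum_(t <- r) h t| <= e.
  move=> e0; have [r [ur re]] := rsummable_tail sb b0 e0; exists r => h hb.
  have [sr Er] := rsum_seqE h ur.
  have sb' : rsummable (fun t => if t \in r then 0 else b t).
    by apply: rsummable_le sb _ => t; case: ifP; rewrite ?normr0 ?ger0_norm.
  have hb' t : `|if t \in r then 0 else h t| <= if t \in r then 0 else b t.
    by case: ifP; rewrite ?normr0.
  have -> : rsum h = rsum (fun t => if t \in r then h t else 0)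
                     + rsum (fun t => if t \in r then 0 else h t).
    rewrite -rsumD //; last exact: rsummable_le sb' hb'.
    by congr rsum; apply/funext => t; case: ifP; rewrite ?addr0 ?add0r.
  by rewrite Er [X in X - _]addrC addrK (le_trans (rsum_le sb' hb')).
have cS : continuous (fun y => rsum (fun t => F t y)).
  apply: continuous_of_uniform_approx => e /tail[r rH].
  exists (fun y => \sum_(t <- r) F t y); split => [|y]; first by have [] := rint2_sum r cF.
  exact: rH.
split => //; apply/eqP; rewrite -subr_eq0 -normr_le0; apply/ler_addgt0Pr => e e0.
rewrite add0r; have e2 : 0 < e / 2 by rewrite divr_gt0.
have [r rH] := tail _ e2.
have [cr Er] := rint2_sum r cF.
have := rH (fun t => rint2 (F t)) (fun t => rint2_bound (cF t) (Fb t)).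
have cN : continuous (fun y => - 1 * \sum_(t <- r) F t y).
  by move=> y; apply: cvgM; [exact: cvg_cst|exact: cr].
have : `|rint2 (fun y => rsum (fun t => F t y) + - 1 * \sum_(t <- r) F t y)| <= e / 2.
  apply: rint2_bound => [y|y]; first by apply: cvgD; [exact: cS|exact: cN].
  by rewrite mulN1r; exact: rH.
rewrite rint2D // rint2Z // mulN1r Er => H1 H2.
have key (u v w : R) : u - v = (u - w) - (v - w) by ring.
rewrite (key _ _ (\sum_(t <- r) rint2 (F t))).
by rewrite (le_trans (ler_normB _ _)) // (splitr e) lerD.
Qed.

Definition ccont f := continuous (fun y => complex.Re (f y)) /\
  continuous (fun y => complex.Im (f y)).

Lemma ccontD f f' : ccont f -> ccont f' -> ccont (fun y => f y + f' y).
Proof.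
move=> [cr ci] [cr' ci']; split.
  by under eq_fun do rewrite Re_addc; move=> y; apply: cvgD; [exact: cr|exact: cr'].
by under eq_fun do rewrite Im_addc; move=> y; apply: cvgD; [exact: ci|exact: ci'].
Qed.

Lemma ccontM f f' : ccont f -> ccont f' -> ccont (fun y => f y * f' y).
Proof.
move=> [cr ci] [cr' ci']; split.
  under eq_fun do rewrite Re_mulc; move=> y.
  by apply: cvgB; apply: cvgM; [exact: cr|exact: cr'|exact: ci|exact: ci'].
under eq_fun do rewrite Im_mulc; move=> y.
by apply: cvgD; apply: cvgM; [exact: cr|exact: ci'|exact: ci|exact: cr'].
Qed.

Lemma ccont_cst (z : C) : ccont (fun=> z).
Proof. by split => y; exact: cvg_cst. Qed.

Lemma cint2D f f' : ccont f -> ccont f' ->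
  cint2 (fun y => f y + f' y) = cint2 f + cint2 f'.
Proof.
move=> [cr ci] [cr' ci']; rewrite /cint2.
have -> : (fun y => complex.Re (f y + f' y)) = fun y => complex.Re (f y) + complex.Re (f' y).
  by apply/funext => y; exact: Re_addc.
have -> : (fun y => complex.Im (f y + f' y)) = fun y => complex.Im (f y) + complex.Im (f' y).
  by apply/funext => y; exact: Im_addc.
by rewrite (rint2D cr cr') (rint2D ci ci').
Qed.

Lemma continuousZ (c : R) g : continuous g -> continuous (fun y => c * g y).
Proof. by move=> cg y; apply: cvgM; [exact: cvg_cst|exact: cg]. Qed.

Lemma cint2Z (z : C) f : ccont f -> cint2 (fun y => z * f y) = z * cint2 f.
Proof.
case: z => a b [cr ci]; rewrite /cint2.
have -> : (fun y => complex.Re ((a +i* b) * f y)) =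
    fun y => a * complex.Re (f y) + (- b) * complex.Im (f y).
  by apply/funext => y; rewrite Re_mulc mulNr.
have -> : (fun y => complex.Im ((a +i* b) * f y)) =
    fun y => a * complex.Im (f y) + b * complex.Re (f y).
  by apply/funext => y; rewrite Im_mulc.
rewrite (rint2D (continuousZ cr) (continuousZ ci)) (rint2D (continuousZ ci) (continuousZ cr)).
by rewrite (rint2Z _ cr) (rint2Z (- b) ci) (rint2Z a ci) (rint2Z b cr) mulNr.
Qed.

Lemma cint2_cst (z : C) : cint2 (fun=> z) = z.
Proof. by case: z => a b; rewrite /cint2 /= !rint2_cst. Qed.

Lemma cint2_csum (T : choiceType) (b : T -> R) (F : T -> R * R -> C) :
  rsummable b -> (forall t, ccont (F t)) -> (forall t y, Normc.normc (F t y) <= b t) ->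
  ccont (fun y => csum (fun t => F t y)) /\
  cint2 (fun y => csum (fun t => F t y)) = csum (fun t => cint2 (F t)).
Proof.
move=> sb cF Fb.
have [c1 E1] := rint2_rsum sb (fun t => (cF t).1) (fun t y => le_trans (Re_le_normc _) (Fb t y)).
have [c2 E2] := rint2_rsum sb (fun t => (cF t).2) (fun t y => le_trans (Im_le_normc _) (Fb t y)).
split; first by split.
by rewrite /cint2 [LHS]/= E1 E2.
Qed.

Lemma periodic_Re f : periodic f -> periodic (fun y => complex.Re (f y)).
Proof. by move=> pf m y; rewrite pf. Qed.

Lemma periodic_Im f : periodic f -> periodic (fun y => complex.Im (f y)).
Proof. by move=> pf m y; rewrite pf. Qed.

Lemma cint2_shift1 f (h : R) : 0 <= h <= 1 -> ccont f -> periodic f ->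
  cint2 (fun y => f (y.1 + h, y.2)) = cint2 f.
Proof.
move=> h01 [cr ci] pf; rewrite /cint2.
by rewrite (rint2_shift1 h01 cr (periodic_Re pf)) (rint2_shift1 h01 ci (periodic_Im pf)).
Qed.

Lemma cint2_shift2 f (h : R) : 0 <= h <= 1 -> ccont f -> periodic f ->
  cint2 (fun y => f (y.1, y.2 + h)) = cint2 f.
Proof.
move=> h01 [cr ci] pf; rewrite /cint2.
by rewrite (rint2_shift2 h01 cr (periodic_Re pf)) (rint2_shift2 h01 ci (periodic_Im pf)).
Qed.

End TorusComplex.

(** * Smooth functions and finite differences *)


Section Smooth.
Variables (R : realType) (V : normedModType R).
Implicit Types (f g : V -> R).

Local Notation iterD vs g := (foldr (fun v (h : V -> R) => 'D_v h) g vs).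

Lemma smooth_differentiable g p : smooth setT g -> differentiable g p.
Proof. by move=> /(_ [::] p I). Qed.

Lemma smooth_derive g v : smooth setT g -> smooth setT ('D_v g).
Proof. by move=> sg vs p _; rewrite -foldr_rcons; exact: sg. Qed.

Lemma smooth_iterD g vs : smooth setT g -> smooth setT (iterD vs g).
Proof. by move=> sg; elim: vs => //= v vs; exact: smooth_derive. Qed.

Lemma smooth_continuous g : smooth setT g -> continuous g.
Proof. by move=> sg p; exact/differentiable_continuous/smooth_differentiable. Qed.

(** A coinduction principle: smooth functions form the largest class of differentiable functions
    stable under directional derivatives. Exhibiting a stable class replaces any formula for
    iterated derivatives. *)
Lemma smooth_coind (P : (V -> R) -> Prop) :
  (forall g p, P g -> differentiable g p) -> (forall g v, P g -> P ('D_v g)) ->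
  forall g, P g -> smooth setT g.
Proof.
move=> Pd PD g Pg vs p _; apply: Pd; elim: vs => //= v vs; exact: PD.
Qed.

Lemma derive_funD f g v : smooth setT f -> smooth setT g ->
  'D_v (fun p => f p + g p) = fun p => 'D_v f p + 'D_v g p.
Proof.
move=> sf sg; apply/funext => p; rewrite -deriveD //;
  exact/diff_derivable/smooth_differentiable.
Qed.

Lemma derive_funM f g v : smooth setT f -> smooth setT g ->
  'D_v (fun p => f p * g p) = fun p => f p * 'D_v g p + g p * 'D_v f p.
Proof.
move=> sf sg; apply/funext => p; rewrite -[RHS]/(f p *: 'D_v g p + g p *: 'D_v f p).
by rewrite -deriveM //; exact/diff_derivable/smooth_differentiable.
Qed.

(** The stable class used for sums and products. Both operations are needed together, as the Leibniz
    rule turns the derivative of a product into a sum of products. *)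
Inductive smooth_alg : (V -> R) -> Prop :=
| smooth_alg_in g : smooth setT g -> smooth_alg g
| smooth_algD f g : smooth_alg f -> smooth_alg g -> smooth_alg (fun p => f p + g p)
| smooth_algM f g : smooth_alg f -> smooth_alg g -> smooth_alg (fun p => f p * g p).

Lemma smooth_alg_diff f p : smooth_alg f -> differentiable f p.
Proof.
elim=> {f} [g|f g _ df _ dg|f g _ df _ dg]; first exact: smooth_differentiable.
  exact: differentiableD.
exact: differentiableM.
Qed.

Lemma smooth_algP f : smooth_alg f -> smooth setT f.
Proof.
apply: smooth_coind => {f} [f p|f v]; first exact: smooth_alg_diff.
elim=> {f} [g sg|f g af df ag dg|f g af df ag dg].
- exact/smooth_alg_in/smooth_derive.
- rewrite (_ : 'D_v _ = fun p => 'D_v f p + 'D_v g p); first exact: smooth_algD.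
  by apply/funext => p; rewrite -deriveD //; exact/diff_derivable/smooth_alg_diff.
- rewrite (_ : 'D_v _ = fun p => f p * 'D_v g p + g p * 'D_v f p).
    by apply: smooth_algD; apply: smooth_algM.
  apply/funext => p; rewrite -[RHS]/(f p *: 'D_v g p + g p *: 'D_v f p).
  by rewrite -deriveM //; exact/diff_derivable/smooth_alg_diff.
Qed.

Lemma smoothD f g : smooth setT f -> smooth setT g -> smooth setT (fun p => f p + g p).
Proof. by move=> sf sg; apply: smooth_algP; apply: smooth_algD; exact: smooth_alg_in. Qed.

Lemma smoothM f g : smooth setT f -> smooth setT g -> smooth setT (fun p => f p * g p).
Proof. by move=> sf sg; apply: smooth_algP; apply: smooth_algM; exact: smooth_alg_in. Qed.

Lemma smooth_cst (c : R) : smooth setT (fun _ : V => c).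
Proof.
apply: (@smooth_coind (fun g => exists c, g = fun=> c)) => [g p [{}c ->]|g v [{}c ->]|].
- exact: differentiable_cst.
- by exists 0; apply/funext => p; rewrite derive_cst.
- by exists c.
Qed.

Lemma smoothN f : smooth setT f -> smooth setT (fun p => - f p).
Proof.
move=> sf; under eq_fun do rewrite -mulN1r.
by apply: smoothM => //; exact: smooth_cst.
Qed.

Lemma derive_shift g (a v p : V) : 'D_v (fun y => g (y + a)) p = 'D_v g (p + a).
Proof.
rewrite /derive; set F := fun h => _; set G := fun h => _.
by rewrite (_ : F = G) //; apply/funext => h; rewrite /F /G /= addrA.
Qed.

Lemma smooth_shift g (a : V) : smooth setT g -> smooth setT (fun y => g (y + a)).
Proof.
move=> sg; apply: (@smooth_coind (fun h => exists2 g, smooth setT g & h = fun y => g (y + a)))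
  => [h p [g' sg' ->]|h v [g' sg' ->]|].
- apply: (@differentiable_comp _ V V R (fun y => y + a) g'); last exact: smooth_differentiable.
  by apply: (@differentiableD _ _ _ id (cst a)).
- exists ('D_v g'); first exact: smooth_derive.
  by apply/funext => p; exact: derive_shift.
- by exists g.
Qed.

(** The mean value theorem applied to [g] along the segment from [y] to [y + h *: e]. *)
Lemma diff_step_bound g (e : V) (h M : R) : smooth setT g -> 0 <= h ->
  (forall y, `|'D_e g y| <= M) -> forall y, `|g (y + h *: e) - g y| <= h * M.
Proof.
move=> sg h0 gM y; pose F s := g (y + s *: e).
have dF (s : R) : is_derive s (1 : R) F ('D_e g (y + s *: e)).
  (* The difference quotient of [F] at [s] is literally that of [g] at [y + s *: e] in the direction
     [e], so derivability and derivative transfer together. *)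
  have E : (fun t => t^-1 *: ((F \o shift s) (t *: 1) - F s)) =
      (fun t => t^-1 *: ((g \o shift (y + s *: e)) (t *: e) - g (y + s *: e))).
    apply/funext => t; rewrite /F /= [_ *: 1]mulr1 scalerDl.
    by congr (_ *: (g _ - _)); rewrite addrCA.
  split; last by rewrite /derive E.
  rewrite /derivable E; exact/diff_derivable/smooth_differentiable.
have cF : {within `[0, h], continuous F}.
  apply: continuous_subspaceT => s; apply/differentiable_continuous/derivable1_diffP.
  exact: (@ex_derive _ _ _ _ _ _ _ (dF s)).
have [c _] := MVT_segment h0 (fun s _ => dF s) cF.
rewrite /F scale0r addr0 subr0 => ->.
by rewrite mulrC normrM (ger0_norm h0) ler_wpM2l.
Qed.

Definition fdiff (p : R * V) g : V -> R := fun y => g (y + p.1 *: p.2) - g y.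

Lemma smooth_fdiff p g : smooth setT g -> smooth setT (fdiff p g).
Proof. by move=> sg; apply: smoothD; [exact: smooth_shift|exact: smoothN]. Qed.

Lemma iterD_fdiff vs p g : smooth setT g -> iterD vs (fdiff p g) = fdiff p (iterD vs g).
Proof.
move=> sg; elim: vs => //= v vs ->; apply/funext => y.
have sh := smooth_iterD vs sg; set h := iterD vs g in sh *.
have /(congr1 (@^~ y)) /= E := derive_funD v (smooth_shift (p.1 *: p.2) sh) (smoothN sh).
rewrite [LHS]E derive_shift; congr (_ + _).
have /(congr1 (@^~ y)) /= := derive_funM v (smooth_cst (-1)) sh.
under eq_fun do rewrite mulN1r; move=> ->.
by rewrite derive_cst mulr0 addr0 mulN1r.
Qed.

(** Each difference costs its step times one derivative in its direction. As differences commute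
    with derivatives, all the derivatives can be collected on [g] itself. *)
Lemma iter_fdiff_bound (l : seq (R * V)) g M : smooth setT g ->
  (forall p, p \in map fst l -> 0 <= p) ->
  (forall y, `|iterD (map snd l) g y| <= M) ->
  forall y, `|foldl (fun f p => fdiff p f) g l y| <= (\prod_(p <- l) p.1) * M.
Proof.
elim: l g M => [|p l IH] g M sg l0 gM y /=; first by rewrite big_nil mul1r.
rewrite big_cons mulrC mulrA mulrC; apply: IH => [|q ql|{}y].
- exact: smooth_fdiff.
- by apply: l0; rewrite inE ql orbT.
rewrite iterD_fdiff // mulrC; apply: diff_step_bound => //; first exact: smooth_iterD.
by apply: l0; rewrite inE eqxx.
Qed.

End Smooth.

(** * Smoothness of trigonometric functions of the first coordinate *)

Section Trig.
Variable R : realType.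
Local Notation V := (R * R)%type.

Lemma derive_dir (F : R -> R) (t a dF : R) : is_derive t 1 F dF -> 'D_a F t = a * dF.
Proof.
move=> [dv dE]; have dif : differentiable F t by exact/derivable1_diffP.
by rewrite deriveE // deriv1E // derive1E dE.
Qed.

Lemma derive_lin1 (F : R -> R) (c dF : R) (v p : V) : is_derive (c * p.1) 1 F dF ->
  'D_v (fun y : V => F (c * y.1)) p = c * v.1 * dF.
Proof.
move=> H; rewrite -(derive_dir (c * v.1) H) /derive.
set f := fun h => _; set g := fun h => _; rewrite (_ : f = g) //; apply/funext => h.
by rewrite /f /g /=; congr (_ *: (F _ - _)); rewrite mulrDr; congr (_ + _); rewrite [LHS]mulrCA.
Qed.

Lemma differentiable_lin1 (F : R -> R) (c : R) (p : V) : derivable F (c * p.1) 1 ->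
  differentiable (fun y : V => F (c * y.1)) p.
Proof.
move=> dF; apply: (@differentiable_comp _ _ _ _ (fun y : V => c * y.1) F);
  last exact/derivable1_diffP.
have lin : linear (fun y : V => c * y.1).
  by move=> t y z /=; rewrite mulrDr; congr (_ + _); rewrite [LHS]mulrCA.
pose Hl := GRing.isLinear.Build _ _ _ _ _ lin.
pose l : {linear V -> R} := HB.pack (fun y : V => c * y.1) Hl.
apply: (@linear_differentiable _ _ _ l) => q.
by apply: cvgM; [exact: cvg_cst|exact: cvg_fst].
Qed.

(** For fixed [c] the span of the two functions is stable under directional derivatives: along [v]
    the coefficients (A, B) become (B c v1, - A c v1). *)
Lemma smooth_trig (A B c : R) :
  smooth setT (fun y : V => A * cos (c * y.1) + B * sin (c * y.1)).
Proof.
apply: (@smooth_coind _ _ (fun g => exists A B,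
  g = fun y : V => A * cos (c * y.1) + B * sin (c * y.1)));
  last by exists A, B.
- move=> g p [a [b ->]].
  have dc := differentiable_lin1 (@derivable_cos R (c * p.1)).
  have ds := differentiable_lin1 (@derivable_sin R (c * p.1)).
  exact: (differentiableD (differentiableM (differentiable_cst a p) dc)
    (differentiableM (differentiable_cst b p) ds)).
- move=> g v [a [b ->]]; exists (b * (c * v.1)), (- a * (c * v.1)); apply/funext => p.
  have dc := diff_derivable (v := v) (differentiable_lin1 (@derivable_cos R (c * p.1))).
  have ds := diff_derivable (v := v) (differentiable_lin1 (@derivable_sin R (c * p.1))).
  have E h (d : R) : derivable h p v -> 'D_v (fun y : V => d * h y) p = d * 'D_v h p.
    by move=> dh; exact: deriveMl.
  have D h (d : R) : derivable h p v -> derivable (fun y : V => d * h y) p v.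
    by move=> dh; exact: (derivableZ (k := d) dh).
  rewrite (deriveD (D _ a dc) (D _ b ds)) !E //.
  rewrite (derive_lin1 _ (is_derive_cos _)) (derive_lin1 _ (is_derive_sin _)).
  ring.
Qed.

End Trig.

(** * Fourier coefficients on the torus *)


Section Fourier.
Variable R : realType.
Local Notation C := R[i].
Local Notation V := (R * R)%type.
Implicit Types (f g : V -> C) (m l : int * int) (y : V).

(** The phase of u^(-m1) w^(-m2) on a fibre. With this sign, pairing with [chi m] extracts the
    coefficient of u^m1 w^m2, in agreement with [coef]. *)
Definition chi m y : C := cis (2 * pi * (m.1%:~R * y.2 - m.2%:~R * y.1)).

Lemma chiD m l y : chi (m + l) y = chi m y * chi l y.
Proof. by rewrite /chi -cisD; congr cis; rewrite !rmorphD; ring. Qed.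

Lemma chi0 y : chi 0 y = 1.
Proof. by rewrite /chi /= !mul0r subrr mulr0 cis0. Qed.

Lemma chi_shift m y v : chi m (y + v) = chi m y * chi m v.
Proof. by rewrite /chi -cisD; congr cis; rewrite /=; ring. Qed.

Lemma normc_chi m y : Normc.normc (chi m y) = 1.
Proof. exact: normc_cis. Qed.

Lemma chi_periodic m : periodic (chi m).
Proof.
move=> l y; rewrite -[(_, _)]/(y + (l.1%:~R, l.2%:~R)) chi_shift.
rewrite /chi /= -!intrM -intrB cis2pi mulr1 //.
Qed.

Lemma ccont_chi m : ccont (chi m).
Proof.
have c : continuous (fun y : V => 2 * pi * (m.1%:~R * y.2 - m.2%:~R * y.1) : R).
  move=> y; apply: cvgM; first exact: cvg_cst.
  by apply: cvgB; apply: cvgM; [exact: cvg_cst|exact: cvg_snd|exact: cvg_cst|exact: cvg_fst].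
split=> y.
  by apply: (continuous_comp (c y)); exact: continuous_cos.
by apply: (continuous_comp (c y)); exact: continuous_sin.
Qed.

Definition fc f m : C := cint2 (fun y => f y * chi m y).

Lemma periodicM f g : periodic f -> periodic g -> periodic (fun y => f y * g y).
Proof. by move=> pf pg m y; rewrite pf pg. Qed.

Lemma fcD f g m : ccont f -> ccont g -> fc (fun y => f y + g y) m = fc f m + fc g m.
Proof.
move=> cf cg; have cc := ccont_chi m; rewrite /fc -(cint2D (ccontM cf cc) (ccontM cg cc)).
by congr cint2; apply/funext => y; rewrite mulrDl.
Qed.

Lemma fcZ (z : C) f m : ccont f -> fc (fun y => z * f y) m = z * fc f m.
Proof.
move=> cf; rewrite /fc -(cint2Z z (ccontM cf (ccont_chi m))).
by congr cint2; apply/funext => y; rewrite mulrA.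
Qed.

Definition axis (e : V) := e = (1, 0) \/ e = (0, 1).

Lemma cint2_shift f (h : R) (e : V) : axis e -> 0 <= h <= 1 -> ccont f -> periodic f ->
  cint2 (fun y => f (y + h *: e)) = cint2 f.
Proof.
move=> [->|->] h01 cf pf.
  rewrite -[RHS](cint2_shift1 h01 cf pf); congr cint2; apply/funext => y; congr (f (_, _)).
    by congr (_ + _); exact: mulr1.
  by rewrite -[RHS]addr0; congr (_ + _); exact: mulr0.
rewrite -[RHS](cint2_shift2 h01 cf pf); congr cint2; apply/funext => y; congr (f (_, _)).
  by rewrite -[RHS]addr0; congr (_ + _); exact: mulr0.
by congr (_ + _); exact: mulr1.
Qed.

Definition half_period m (p : R * V) :=
  [/\ axis p.2, 0 <= p.1 <= 1 & chi m (p.1 *: p.2) = - 1].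

(** In [chi m] the first frequency multiplies the second angle, hence the direction (0, 1). The step
    1/(2|m1|) turns the phase by pi or -pi according to the sign of m1. *)
Lemma half_period1 m : m.1 != 0 -> half_period m ((2 * `|m.1|%:~R)^-1, (0, 1)).
Proof.
move=> m0; have a1 : 1 <= (`|m.1|%:~R : R) by rewrite ler1z -gtz0_ge1 normr_gt0.
split; first by right.
  by rewrite /= invr_ge0 mulr_ge0 ?(le_trans _ a1) //= invf_le1; nra.
rewrite /chi -[((_ : R) *: _).1]/(_ * 0) -[((_ : R) *: _).2]/(_ * 1).
rewrite !mulr0 subr0 mulr1 /=.
have [mp|mn] := ltP 0 m.1.
  rewrite gtr0_norm // in a1 *; rewrite (_ : _ * _ = pi) ?cispi //.
  by field; rewrite intr_eq0.
rewrite ler0_norm // in a1 *; rewrite (_ : _ * _ = - pi) ?cisNpi //.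
by rewrite rmorphN; field; rewrite intr_eq0.
Qed.

Lemma half_period2 m : m.2 != 0 -> half_period m ((2 * `|m.2|%:~R)^-1, (1, 0)).
Proof.
move=> m0; have a1 : 1 <= (`|m.2|%:~R : R) by rewrite ler1z -gtz0_ge1 normr_gt0.
split; first by left.
  by rewrite /= invr_ge0 mulr_ge0 ?(le_trans _ a1) //= invf_le1; nra.
rewrite /chi -[((_ : R) *: _).1]/(_ * 1) -[((_ : R) *: _).2]/(_ * 0).
rewrite !mulr0 sub0r mulr1 /=.
have [mp|mn] := ltP 0 m.2.
  rewrite gtr0_norm // in a1 *; rewrite (_ : _ * _ = - pi) ?cisNpi //.
  by field; rewrite intr_eq0.
rewrite ler0_norm // in a1 *; rewrite (_ : _ * _ = pi) ?cispi //.
by rewrite rmorphN; field; rewrite intr_eq0.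
Qed.

(** For nonzero [m], translating by a half period preserves the integral and changes its sign, so it
    vanishes. *)
Lemma cint2_chi m : cint2 (chi m) = if m == 0 then 1 else 0.
Proof.
have [->|m0] := eqVneq m 0.
  by rewrite -[RHS](cint2_cst (1 : C)); congr cint2; apply/funext => y; rewrite chi0.
have [p [ax h01 hm]] : exists p, half_period m p.
  have [m1|m1] := eqVneq m.1 0; last by eexists; exact: half_period1.
  have [m2|m2] := eqVneq m.2 0; last by eexists; exact: half_period2.
  by case/eqP: m0; rewrite [m]surjective_pairing m1 m2.
have /eqP := cint2_shift ax h01 (ccont_chi m) (@chi_periodic m).
rewrite (_ : (fun y => _) = fun y => - 1 * chi m y); last first.
  by apply/funext => y; rewrite chi_shift hm mulrC.
rewrite (cint2Z _ (ccont_chi m)) mulN1r eq_sym -addr_eq0 -mulr2n mulrn_eq0 /=.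
by move=> /eqP.
Qed.

Lemma fc_cst (z : C) m : fc (fun=> z) m = if m == 0 then z else 0.
Proof.
by rewrite /fc (cint2Z _ (ccont_chi m)) cint2_chi; case: ifP; rewrite ?mulr1 ?mulr0.
Qed.

Definition cfdiff (p : R * V) f : V -> C := fun y => f (y + p.1 *: p.2) - f y.

Lemma ccont_shift f (a : V) : ccont f -> ccont (fun y => f (y + a)).
Proof.
have ca : continuous (fun y : V => y + a).
  by move=> y; apply: differentiable_continuous; exact: (@differentiableD _ V V id (cst a)).
move=> [cr ci]; split => y.
  exact: (@continuous_comp _ _ _ (fun y => y + a) (fun y => complex.Re (f y)) y (ca y) (cr _)).
exact: (@continuous_comp _ _ _ (fun y => y + a) (fun y => complex.Im (f y)) y (ca y) (ci _)).
Qed.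

Lemma ccontN f : ccont f -> ccont (fun y => - 1 * f y).
Proof. by move=> cf; apply: ccontM cf; exact: ccont_cst. Qed.

Lemma ccont_cfdiff p f : ccont f -> ccont (cfdiff p f).
Proof.
move=> cf; rewrite (_ : cfdiff p f = fun y => f (y + p.1 *: p.2) + - 1 * f y).
  by apply: ccontD; [exact: ccont_shift|exact: ccontN].
by apply/funext => y; rewrite mulN1r.
Qed.

Lemma periodic_shift f (a : V) : periodic f -> periodic (fun y => f (y + a)).
Proof.
by move=> pf m y; rewrite -[RHS](pf m); congr (f (_, _)); rewrite /= addrAC.
Qed.

Lemma periodic_cfdiff p f : periodic f -> periodic (cfdiff p f).
Proof. by move=> pf m y; rewrite /cfdiff (periodic_shift (p.1 *: p.2) pf) pf. Qed.

Lemma fc_cfdiff p f m : half_period m p -> ccont f -> periodic f ->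
  fc (cfdiff p f) m = - 2 * fc f m.
Proof.
move=> [ax h01 hm] cf pf; have cc := ccont_chi m.
rewrite (_ : cfdiff p f = fun y => f (y + p.1 *: p.2) + - 1 * f y); last first.
  by apply/funext => y; rewrite mulN1r.
rewrite (fcD _ (ccont_shift (p.1 *: p.2) cf) (ccontN cf)) (fcZ _ _ cf).
suff -> : fc (fun y => f (y + p.1 *: p.2)) m = - 1 * fc f m by ring.
rewrite /fc -[in RHS](cint2_shift ax h01 (ccontM cf cc) (periodicM pf (@chi_periodic m))).
rewrite -cint2Z; last exact: (ccont_shift _ (ccontM cf cc)).
by congr cint2; apply/funext => y; rewrite chi_shift hm; ring.
Qed.

(** The real and imaginary parts are bounded separately, whence the factor 2 in the bound. *)
Lemma normc_fc_le f m (M : R) : ccont f -> (forall y, Normc.normc (f y) <= M) ->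
  Normc.normc (fc f m) <= M + M.
Proof.
move=> cf fM; have [cr ci] := ccontM cf (ccont_chi m).
have b y : Normc.normc (f y * chi m y) <= M by rewrite Normc.normcM normc_chi mulr1.
apply: (le_trans (normc_le _)); apply: lerD.
  exact: rint2_bound cr (fun y => le_trans (Re_le_normc _) (b y)).
exact: rint2_bound ci (fun y => le_trans (Im_le_normc _) (b y)).
Qed.

(** Every half-period difference multiplies the coefficient by -2, so its modulus does not decrease;
    the gain is discarded. *)
Lemma normc_fc_cfdiff (s : seq (R * V)) f m : (forall p, p \in s -> half_period m p) ->
  ccont f -> periodic f ->
  ccont (foldl (fun f p => cfdiff p f) f s) /\
  Normc.normc (fc f m) <= Normc.normc (fc (foldl (fun f p => cfdiff p f) f s) m).
Proof.
elim: s f => [|p s IH] f hs cf pf; first by split; [exact: cf|exact: lexx].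
have hs' q : q \in s -> half_period m q by move=> qs; apply: hs; rewrite inE qs orbT.
have [c le] := IH (cfdiff p f) hs' (ccont_cfdiff p cf) (periodic_cfdiff p pf).
split; [exact: c|apply: le_trans le].
rewrite (fc_cfdiff (hs p (mem_head p s)) cf pf) Normc.normcM.
rewrite (_ : Normc.normc (- 2) = 2); last by rewrite normcN normcMn Normc.normc1.
by rewrite mulr_natl mulr2n lerDl normc_ge0.
Qed.

Lemma ReIm_cfdiff (s : seq (R * V)) f y :
  complex.Re (foldl (fun f p => cfdiff p f) f s y) =
    foldl (fun (h : V -> R) p => fdiff p h) (fun y => complex.Re (f y)) s y /\
  complex.Im (foldl (fun f p => cfdiff p f) f s y) =
    foldl (fun (h : V -> R) p => fdiff p h) (fun y => complex.Im (f y)) s y.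
Proof.
elim: s f => [|p s IH] f //=; have [-> ->] := IH (cfdiff p f).
split; congr (foldl _ _ _ _); apply/funext => z; rewrite /cfdiff /fdiff.
  by rewrite Re_addc Re_oppc.
by rewrite Im_addc Im_oppc.
Qed.

(** The square of the half-period step attached to frequency [j], one factor for each of two
    differences. At frequency 0 no difference is taken, hence the value 1. *)
Definition fweight (j : int) : R := if j == 0 then 1 else ((2 * `|j|%:~R) ^- 2).

Lemma periodic_iterD (vs : seq V) (g : V -> R) : periodic g ->
  periodic (foldr (fun v (h : V -> R) => 'D_v h) g vs).
Proof.
move=> pg m; elim: vs => [|v vs IH] y; first exact: pg.
move: IH => /=; set h := foldr _ _ _ => IH; pose a : V := (m.1%:~R, m.2%:~R).
have E : (fun z => h (z + a)) = h by apply/funext => z; exact: IH.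
by have := derive_shift h a v y; rewrite E => ->.
Qed.

(* Translating by half a period of [chi m] flips its sign, so a finite
   difference multiplies the coefficient by -2; two differences along each axis
   with nonzero frequency, bounded by the mean value theorem, give the decay. *)
Lemma fc_decay f : csmooth setT f -> periodic f ->
  exists M, forall m, Normc.normc (fc f m) <= M * (fweight m.1 * fweight m.2).
Proof.
move=> [sr si] pf.
have cf : ccont f by split; exact: smooth_continuous.
have bnd (vs : seq V) : exists2 M, 0 <= M & forall y,
    `|foldr (fun v (h : V -> R) => 'D_v h) (fun y => complex.Re (f y)) vs y| <= M /\
    `|foldr (fun v (h : V -> R) => 'D_v h) (fun y => complex.Im (f y)) vs y| <= M.
  have [M1 b1] := periodic_bounded (smooth_continuous (smooth_iterD vs sr))
    (periodic_iterD vs (periodic_Re pf)).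
  have [M2 b2] := periodic_bounded (smooth_continuous (smooth_iterD vs si))
    (periodic_iterD vs (periodic_Im pf)).
  have M10 : 0 <= M1 := le_trans (normr_ge0 _) (b1 0).
  have M20 : 0 <= M2 := le_trans (normr_ge0 _) (b2 0).
  exists (M1 + M2) => [|y]; first exact: addr_ge0.
  by split; [rewrite (le_trans (b1 y)) ?lerDl|rewrite (le_trans (b2 y)) ?lerDr].
pose e1 : V := (0, 1); pose e2 : V := (1, 0).
have [Ma a0 Ha] := bnd [::].
have [Mb b0 Hb] := bnd [:: e1; e1].
have [Mc c0 Hc] := bnd [:: e2; e2].
have [Md d0 Hd] := bnd [:: e1; e1; e2; e2].
pose M := Ma + Mb + Mc + Md.
have key (s : seq (R * V)) m M' : (forall p, p \in s -> half_period m p) ->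
    (forall y,
      `|foldr (fun v (h : V -> R) => 'D_v h) (fun y => complex.Re (f y)) (map snd s) y| <= M' /\
      `|foldr (fun v (h : V -> R) => 'D_v h) (fun y => complex.Im (f y)) (map snd s) y| <= M') ->
    M' <= M -> Normc.normc (fc f m) <= 4 * M * \prod_(p <- s) p.1.
  move=> hs H MM; have [c le] := normc_fc_cfdiff hs cf pf.
  have s0 p : p \in map fst s -> 0 <= p.
    by move=> /mapP[q /hs[_ /andP[q0 _] _] ->].
  have P0 : 0 <= \prod_(p <- s) p.1.
    by rewrite big_seq; apply: prodr_ge0 => p /hs[_ /andP[]].
  apply: (le_trans le); set P := \prod_(p <- s) p.1 in P0 *.
  have L : P * M' <= P * M by rewrite ler_wpM2l.
  (* The 4 is 2 times 2: [normc_le] bounds a modulus by the sum of two parts, and [normc_fc_le]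
     doubles once more. *)
  rewrite (_ : 4 * M * P = (P * M + P * M) + (P * M + P * M)); last by ring.
  apply: normc_fc_le c _ => y; apply: (le_trans (normc_le _)).
  have [-> ->] := ReIm_cfdiff s f y; apply: lerD; apply: le_trans L.
    by apply: iter_fdiff_bound => // z; have [] := H z.
  by apply: iter_fdiff_bound => // z; have [] := H z.
exists (4 * M) => m; rewrite /fweight.
pose q1 : R * V := ((2 * `|m.1|%:~R)^-1, e1); pose q2 : R * V := ((2 * `|m.2|%:~R)^-1, e2).
have [m1|m1] := eqVneq m.1 0; have [m2|m2] := eqVneq m.2 0.
- have -> : 1 * 1 = \prod_(p <- [::] : seq (R * V)) p.1 by rewrite big_nil mulr1.
  by apply: (key _ m Ma) => [//|y|]; [exact: Ha|rewrite /M; lra].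
- have -> : 1 * (2 * `|m.2|%:~R) ^- 2 = \prod_(p <- [:: q2; q2]) p.1.
    by rewrite !big_cons big_nil mulr1 mul1r -exprVn expr2.
  apply: (key _ m Mc) => [p|y|]; [|exact: Hc|rewrite /M; lra].
  by rewrite !inE => /orP[] /eqP ->; exact: half_period2.
- have -> : (2 * `|m.1|%:~R) ^- 2 * 1 = \prod_(p <- [:: q1; q1]) p.1.
    by rewrite !big_cons big_nil !mulr1 -exprVn expr2.
  apply: (key _ m Mb) => [p|y|]; [|exact: Hb|rewrite /M; lra].
  by rewrite !inE => /orP[] /eqP ->; exact: half_period1.
- have -> : (2 * `|m.1|%:~R) ^- 2 * (2 * `|m.2|%:~R) ^- 2 = \prod_(p <- [:: q1; q1; q2; q2]) p.1.
    by rewrite !big_cons big_nil mulr1 -!exprVn !expr2 !mulrA.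
  apply: (key _ m Md) => [p|y|]; [|exact: Hd|rewrite /M; lra].
  rewrite !inE => /or4P[] /eqP ->;
    by [exact: half_period1|exact: half_period1|exact: half_period2|exact: half_period2].
Qed.

(** A telescoping series: the sum of the first n terms is 1 - 1/(n + 1). *)
Lemma rsummable_nat : rsummable (fun n : nat => ((n.+1 * n.+2)%:R)^-1 : R).
Proof.
rewrite /rsummable /summable.
rewrite (_ : (fun t => _) = fun n : nat => (((n.+1 * n.+2)%:R)^-1 : R)%:E); last first.
  by apply/funext => n /=; rewrite ger0_norm // invr_ge0 ler0n.
have ge0 (n : nat) : (0 <= (((n.+1 * n.+2)%:R)^-1 : R)%:E)%E by rewrite lee_fin invr_ge0 ler0n.
rewrite -nneseries_esumT //; apply: (@le_lt_trans _ _ 1%E); last by rewrite ltry.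
apply: lime_le; first by apply: is_cvg_nneseries => n _ _; exact: ge0.
apply: nearW => n; rewrite sumEFin lee_fin.
suff -> : \sum_(0 <= i < n) ((i.+1 * i.+2)%:R)^-1 = 1 - (n.+1%:R)^-1 :> R.
  by rewrite gerBl invr_ge0 ler0n.
elim: n => [|n IH]; first by rewrite big_nil invr1 subrr.
rewrite big_nat_recr //= IH natrM -!natr1; field.
by rewrite !natr1 !pnatr_eq0.
Qed.

(** Signs and magnitudes follow the constructors of [int]; since [Negz n] is - (n + 1), zero is
    coded only once. *)
Definition int_of_signed (p : bool * nat) : int := if p.1 then Posz p.2 else Negz p.2.

Lemma int_of_signed_bij : bijective int_of_signed.
Proof.
exists (fun j => match j with Posz n => (true, n) | Negz n => (false, n) end).
  by case=> [[]].
by case.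
Qed.

Lemma rsummable_fweight : rsummable fweight.
Proof.
have sb : rsummable (fun b : bool => 1 : R).
  have [+ _] := rsum_seqE (fun _ : bool => 1 : R) (isT : uniq [:: true; false]).
  by rewrite (_ : (fun t => _) = fun=> 1) //; apply/funext => -[].
(* The factor 2 is dictated by frequency 0, where the weight 1 equals 2 / (1 * 2). *)
have sp := rsummable_prod sb (rsummableZ 2 rsummable_nat).
have [inv invK Kinv] := int_of_signed_bij.
suff H : rsummable (fweight \o int_of_signed).
  have := rsummable_reindex (Bijective Kinv invK) H.
  by rewrite (_ : _ \o inv = fweight) //; apply/funext => j /=; rewrite Kinv.
apply: rsummable_le sp _ => -[b n] /=; rewrite mul1r /fweight /int_of_signed /=.
(* Here [k] is the absolute value of the coded integer, n for [Posz n] and n + 1 for [Negz n]. The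
   inequality amounts to (n + 1)(n + 2) <= 8 k^2. *)
have w0 k : (0 < k)%N -> (k <= n.+1)%N -> (n <= k)%N ->
    (2 * (k%:Z)%:~R : R) ^- 2 <= 2 * (n.+1 * n.+2)%:R^-1.
  move=> k0 kn nk; rewrite -[2 in leRHS]invrK -invfM lef_pV2 ?posrE; last 2 first.
  - by rewrite exprn_gt0 // mulr_gt0 // ltr0z.
  - by rewrite mulr_gt0 ?invr_gt0 // ltr0n.
  rewrite -pmulrn -natrM -natrX ler_pdivrMl // -natrM ler_nat.
  nia.
case: b => /=.
  case: eqP => [[->]|/eqP n0]; first by rewrite normr1; lra.
  by rewrite ger0_norm ?invr_ge0 ?sqr_ge0 //; apply: w0; lia.
by rewrite ger0_norm ?invr_ge0 ?sqr_ge0 //; apply: w0; lia.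
Qed.

Lemma csummable_fc f : csmooth setT f -> periodic f -> csummable (fc f).
Proof.
move=> sf pf; have [M fM] := fc_decay sf pf.
exact: csummable_le (rsummableZ M (rsummable_prod rsummable_fweight rsummable_fweight)) fM.
Qed.

End Fourier.

(** * The Weyl operators on the polarized sections *)


Section ComplexCalculus.
Variables (R : realType) (V : normedModType R).
Local Notation C := R[i].
Implicit Types (f g : V -> C).

Lemma csmoothD f g : csmooth setT f -> csmooth setT g -> csmooth setT (fun y => f y + g y).
Proof.
move=> [fr fi] [gr gi]; split.
  by under eq_fun do rewrite Re_addc; exact: smoothD.
by under eq_fun do rewrite Im_addc; exact: smoothD.
Qed.

Lemma csmoothM f g : csmooth setT f -> csmooth setT g -> csmooth setT (fun y => f y * g y).
Proof.
move=> [fr fi] [gr gi]; split.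
  under eq_fun do rewrite Re_mulc; apply: smoothD; first exact: smoothM.
  by apply: smoothN; exact: smoothM.
by under eq_fun do rewrite Im_mulc; apply: smoothD; exact: smoothM.
Qed.

Lemma csmooth_cst (z : C) : csmooth setT (fun _ : V => z).
Proof. by split; exact: smooth_cst. Qed.

Lemma csmooth_shift f (a : V) : csmooth setT f -> csmooth setT (fun y => f (y + a)).
Proof. by move=> [fr fi]; split; [exact: smooth_shift fr|exact: smooth_shift fi]. Qed.

Lemma cderD f g v y : csmooth setT f -> csmooth setT g ->
  cder (fun y => f y + g y) v y = cder f v y + cder g v y.
Proof.
move=> [fr fi] [gr gi]; rewrite /cder.
have -> : (fun p => complex.Re (f p + g p)) = fun p => complex.Re (f p) + complex.Re (g p).
  by apply/funext => p; exact: Re_addc.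
have -> : (fun p => complex.Im (f p + g p)) = fun p => complex.Im (f p) + complex.Im (g p).
  by apply/funext => p; exact: Im_addc.
have /(congr1 (@^~ y)) /= -> := derive_funD v fr gr.
by have /(congr1 (@^~ y)) /= -> := derive_funD v fi gi.
Qed.

Lemma cderM f g v y : csmooth setT f -> csmooth setT g ->
  cder (fun y => f y * g y) v y = f y * cder g v y + g y * cder f v y.
Proof.
move=> [fr fi] [gr gi]; rewrite /cder.
have -> : (fun p => complex.Re (f p * g p)) =
    fun p => complex.Re (f p) * complex.Re (g p) + (- complex.Im (f p)) * complex.Im (g p).
  by apply/funext => p; rewrite Re_mulc mulNr.
have -> : (fun p => complex.Im (f p * g p)) =
    fun p => complex.Re (f p) * complex.Im (g p) + complex.Im (f p) * complex.Re (g p).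
  by apply/funext => p; exact: Im_mulc.
have /(congr1 (@^~ y)) /= -> := derive_funD v (smoothM fr gr) (smoothM (smoothN fi) gi).
have /(congr1 (@^~ y)) /= -> := derive_funD v (smoothM fr gi) (smoothM fi gr).
have /(congr1 (@^~ y)) /= -> := derive_funM v fr gr.
have /(congr1 (@^~ y)) /= -> := derive_funM v (smoothN fi) gi.
have /(congr1 (@^~ y)) /= -> := derive_funM v fr gi.
have /(congr1 (@^~ y)) /= -> := derive_funM v fi gr.
have -> : 'D_v (fun p => - complex.Im (f p)) y = - 'D_v (fun p => complex.Im (f p)) y.
  have /(congr1 (@^~ y)) /= := derive_funM v (smooth_cst (-1)) fi.
  under eq_fun do rewrite mulN1r; move=> ->.
  by rewrite derive_cst mulr0 addr0 mulN1r.
apply: complexP; rewrite ?Re_addc ?Im_addc ?Re_mulc ?Im_mulc /=; ring.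
Qed.

Lemma cder_shift f (a v y : V) : cder (fun y => f (y + a)) v y = cder f v (y + a).
Proof. by rewrite /cder -!derive_shift. Qed.

Lemma cder_cst (z : C) (v y : V) : cder (fun _ : V => z) v y = 0.
Proof. by rewrite /cder !derive_cst. Qed.

End ComplexCalculus.

Section Plane.
Variables (R : realType).
Local Notation C := R[i].
Local Notation V := (R * R)%type.

Lemma csmooth_cis (c : R) : csmooth setT (fun y : V => cis (c * y.1)).
Proof.
split => /=.
  have := smooth_trig 1 0 c; congr (smooth setT _); apply/funext => y.
  by rewrite mul1r mul0r addr0.
have := smooth_trig 0 1 c; congr (smooth setT _); apply/funext => y.
by rewrite mul1r mul0r add0r.
Qed.

Lemma cder_cis (c : R) (v y : V) :
  cder (fun y : V => cis (c * y.1)) v y = cI R * (c * v.1)%:C * cis (c * y.1).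
Proof.
rewrite /cder /= (derive_lin1 _ (is_derive_cos _)) (derive_lin1 _ (is_derive_sin _)).
apply: complexP; rewrite ?Re_mulc ?Im_mulc /=; ring.
Qed.

Lemma normc_expz (z : C) (j : int) : Normc.normc z = 1 -> Normc.normc (z ^ j) = 1.
Proof.
move=> z1; have nat (i : nat) : Normc.normc (z ^+ i) = 1.
  by elim: i => [|i IH]; rewrite ?expr0 ?Normc.normc1 // exprS Normc.normcM z1 IH mulr1.
case: j => i; first exact: nat.
by rewrite NegzE -exprnN Normc.normcV nat invr1.
Qed.

End Plane.

Section Weyl.
Variables (R : realType) (k : nat).
Hypothesis k_gt0 : (0 < k)%N.
Local Notation C := R[i].
Local Notation V := (R * R)%type.
Implicit Types (m l : int * int) (psi : V -> C) (y : V).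
Local Notation K := ((2 * k)%:R : R).

Lemma cexp_cI (t : R) : cexp (cI R * t%:C) = cis t.
Proof.
rewrite (_ : cI R * t%:C = 0 +i* t); first by rewrite cexpE expR0 mul1r.
by apply: complexP; rewrite ?Re_mulc ?Im_mulc /=; ring.
Qed.

Lemma phaseE m l : phase R k m l = cis (- ((m.1 * l.2 - l.1 * m.2)%:~R / 2 * pi / k%:R)).
Proof. by rewrite /phase /qpow cexpN cexp_cI cisN. Qed.

Lemma normc_phase m l : Normc.normc (phase R k m l) = 1.
Proof. by rewrite phaseE normc_cis. Qed.

Definition weyl_shift m : V := (m.1%:~R / K, m.2%:~R / K).

(** The term free of [y] makes the cocycle antisymmetric: without it, composing two operators would
    produce exp(-2 pi i m1 l2/(2k)) in place of [phase]. *)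
Definition weyl_factor m y : C :=
  cis (- (pi * m.1%:~R * m.2%:~R / K) - 2 * pi * m.2%:~R * y.1).

Definition weyl m psi : V -> C := fun y => weyl_factor m y * psi (y + weyl_shift m).

Lemma k_neq0 : k%:R != 0 :> R.
Proof. by rewrite pnatr_eq0; lia. Qed.

Lemma weyl0 psi : weyl 0 psi = psi.
Proof.
apply/funext => y; rewrite /weyl /weyl_factor /weyl_shift /= !mulr0 !mul0r.
rewrite subr0 oppr0 cis0 mul1r; congr psi.
by rewrite [RHS]surjective_pairing; congr (_, _); exact: addr0.
Qed.

Lemma weyl_comp m l psi y :
  weyl m (weyl l psi) y = phase R k m l * weyl (m + l) psi y.
Proof.
rewrite /weyl /weyl_factor phaseE !mulrA -!cisD; congr (cis _ * psi _).
  rewrite /weyl_shift /= !intrD !intrM natrM; field; exact: k_neq0.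
rewrite -addrA; congr (_ + _).
by apply: injective_projections; rewrite /= intrD mulrDl.
Qed.

Lemma cI_oppr_mulrn (t : R) : - (cI R * t%:C) *+ k = cI R * (- (t * k%:R))%:C.
Proof.
have -> : (- (t * k%:R))%:C = - (t%:C *+ k) by rewrite rmorphN mulr_natr rmorphMn.
by rewrite mulrN mulrnAr mulNrn.
Qed.

Section Polarized.
Variables (n : nat) (cd : chart_data R n) (U : chart n) (b : R * R).
Variables (yc : R * R) (J : R * R -> R * R) (eps : bool * bool).
Local Notation H := (polarized cd k U b yc J eps).

(** The real 1-form for which [nabla] is d + i [conn_form]. The dx2 term of [conn_L] vanishes on
    vectors tangent to the fibre, and the flat form enters with the opposite sign because the bundle
    is dualised. *)
Definition conn_form (v y : V) : R :=
  - (2 * pi * (2 * y.2 * v.1) * k%:R) + 2 * pi * (yc.1 * v.1 + yc.2 * v.2).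

Lemma nablaE psi v y : nabla cd k U b yc psi v y =
  cder psi v y + cI R * (conn_form v y)%:C * psi y.
Proof.
rewrite /nabla /conn_L /conn_flat opprK /= mulr0 mul0r add0r cI_oppr_mulrn.
by rewrite -mulrDr -rmorphD.
Qed.

Lemma conn_form_shift v y m :
  conn_form v (y + weyl_shift m) = conn_form v y - 2 * pi * m.2%:~R * v.1.
Proof.
by rewrite /conn_form /weyl_shift natrM /=; field; exact: k_neq0.
Qed.

Lemma polarized_lin (t : C) psi phi : H psi -> H phi -> H (fun y => t * psi y + phi y).
Proof.
move=> [s1 q1 p1] [s2 q2 p2].
have st : csmooth setT (fun y => t * psi y) by apply: csmoothM => //; exact: csmooth_cst.
have lin v y : nabla cd k U b yc (fun y => t * psi y + phi y) v y =
    t * nabla cd k U b yc psi v y + nabla cd k U b yc phi v y.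
  rewrite !nablaE cderD // cderM //; last exact: csmooth_cst.
  by rewrite cder_cst mulr0 addr0; ring.
split; first exact: csmoothD.
  by move=> m y; rewrite q1 q2; ring.
by move=> v y; rewrite !lin p1 p2; ring.
Qed.

Lemma polarized0 psi : H psi -> H (fun=> 0).
Proof.
move=> Hpsi; have := polarized_lin (-1) Hpsi Hpsi.
by congr (H _); apply/funext => y; rewrite mulN1r addNr.
Qed.

Lemma polarized_sum (I : Type) (r : seq I) (t : I -> C) (psi : I -> V -> C) phi :
  H phi -> (forall i, H (psi i)) -> H (fun y => \sum_(i <- r) t i * psi i y).
Proof.
move=> Hphi Hpsi; elim: r => [|i r IH].
  by under eq_fun do rewrite big_nil; exact: polarized0 Hphi.
by under eq_fun do rewrite big_cons; exact: polarized_lin.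
Qed.

Lemma factor_LE m y : factor_L m y ^+ k = cis (4 * pi * m.2%:~R * y.1 * k%:R).
Proof. by rewrite /factor_L cexp_cI mulr_natr; exact/esym/(cis_int _ (Posz k)). Qed.

Lemma weyl_polarized m psi : H psi -> H (weyl m psi).
Proof.
move=> [s q p]; pose c : R := - (2 * pi * m.2%:~R).
pose al := cis (- (pi * m.1%:~R * m.2%:~R / K)).
have E phi : weyl m phi = fun y => al * (cis (c * y.1) * phi (y + weyl_shift m)).
  by apply/funext => y; rewrite /weyl /weyl_factor cisD /c mulNr mulrA.
have ss := csmooth_shift (weyl_shift m) s.
have sc := csmooth_cis c.
have sw : csmooth setT (weyl m psi).
  by rewrite E; apply: csmoothM; [exact: csmooth_cst|exact: csmoothM].
(* The Weyl operator commutes with the connection: the derivative of [cis (c * y.1)] contributes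
   exactly the change of [conn_form] under the shift. *)
have D v y : nabla cd k U b yc (weyl m psi) v y =
    weyl m (nabla cd k U b yc psi v) y.
  rewrite !E !nablaE cderM; [|exact: csmooth_cst|exact: csmoothM].
  rewrite cder_cst mulr0 addr0 cderM // cder_shift cder_cis.
  have -> : conn_form v (y + weyl_shift m) = conn_form v y + c * v.1.
    by rewrite conn_form_shift /c mulNr.
  have -> : (conn_form v y + c * v.1)%:C = (conn_form v y)%:C + (c * v.1)%:C.
    exact: rmorphD.
  set ps := psi _; set dp := cder psi _ _; set e := cis (c * _).
  set z1 := (conn_form v y)%:C; set z2 := (c * v.1)%:C.
  clearbody ps dp e al z1 z2; ring.
split => // [l y|v y].
  rewrite /weyl -[(_, _)]/(y + (l.1%:~R, l.2%:~R)) addrAC.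
  rewrite -[y + weyl_shift m + _]/((y + weyl_shift m).1 + l.1%:~R,
    (y + weyl_shift m).2 + l.2%:~R) q.
  rewrite !factor_LE /weyl_factor.
  set ps := psi _; set fK := factor_K _ _ _.
  rewrite [in RHS]mulrA -[in RHS](mulrA fK) -cisD !mulrA [_ * fK]mulrC -!mulrA.
  congr (fK * _); rewrite mulrA -cisD; congr (_ * ps).
  (* The shift changes the automorphy factor by exp(2 pi i m1 l2), and the period [l] changes the
     gauge factor by exp(-2 pi i m2 l1). Both are 1 because the shift lies in the lattice of step
     1/(2k). *)
  rewrite -[RHS]mulr1 -(cis2pi R (m.1 * l.2 - m.2 * l.1)) -cisD; congr cis.
  rewrite /weyl_shift /= intrB !intrM natrM; field; exact: k_neq0.
by rewrite !D /weyl p mulrCA.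
Qed.

Lemma normc_factor_K l : Normc.normc (factor_K R eps l) = 1.
Proof.
rewrite /factor_K; apply: normc_expz.
by rewrite -cispi normc_cis.
Qed.

Definition residue m : int * int := ((m.1 %% (2 * k)%:Z)%Z, (m.2 %% (2 * k)%:Z)%Z).

(** Writing m = r + 2k l, the shifts differ by the period [l], which quasi-periodicity absorbs. The
    scalar is constant because the exponent 4 pi k l2 y1 of the automorphy factor cancels the part
    -2 pi (2k l2) y1 of [weyl_factor]. It is chosen before [psi] and so depends on [m] alone. *)
Lemma weyl_residue m : exists2 z : C, Normc.normc z = 1 &
  forall psi, H psi -> forall y, weyl m psi y = z * weyl (residue m) psi y.
Proof.
pose l : int * int := ((m.1 %/ (2 * k)%:Z)%Z, (m.2 %/ (2 * k)%:Z)%Z).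
set r := residue m.
have m1 : m.1%:~R = r.1%:~R + K * l.1%:~R :> R.
  by rewrite [in LHS](divz_eq m.1 (2 * k)%:Z) intrD intrM mulrC addrC.
have m2 : m.2%:~R = r.2%:~R + K * l.2%:~R :> R.
  by rewrite [in LHS](divz_eq m.2 (2 * k)%:Z) intrD intrM mulrC addrC.
pose t : R := - (pi * m.1%:~R * m.2%:~R / K) + pi * r.1%:~R * r.2%:~R / K
  + 2 * pi * l.2%:~R * r.1%:~R.
exists (factor_K R eps l * cis t) => [|psi [_ q _] y].
  by rewrite Normc.normcM normc_factor_K normc_cis mulr1.
rewrite /weyl.
have -> : y + weyl_shift m =
    ((y + weyl_shift r).1 + l.1%:~R, (y + weyl_shift r).2 + l.2%:~R).
  by congr (_, _); rewrite /weyl_shift /= -addrA; congr (_ + _);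
    rewrite ?m1 ?m2; field; exact: k_neq0.
rewrite q factor_LE; set ps := psi _; set fK := factor_K _ _ _.
rewrite !mulrA [_ * fK]mulrC -!mulrA; congr (fK * _); rewrite !mulrA; congr (_ * ps).
rewrite /weyl_factor -!cisD; congr cis; rewrite /t m1 m2 /weyl_shift /= !natrM; field.
exact: k_neq0.
Qed.

End Polarized.
End Weyl.

(** * The representation of the twisted convolution algebra *)


Section TwistedConvolution.
Variables (R : realType) (k : nat).
Local Notation C := R[i].
Local Notation V := (R * R)%type.
Local Notation Z2 := (int * int)%type.
Implicit Types (a b : Z2 -> C) (m l : Z2).

(** Written as a sum over all pairs with an indicator, in the shape of the double sum in
    [star_chart]. *)
Definition tconv a b (l : Z2) : C := csum (fun p : Z2 * Z2 =>
  if p.1 + p.2 == l then phase R k p.1 p.2 * a p.1 * b p.2 else 0).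

Lemma csummable_phase a b : csummable a -> csummable b ->
  csummable (fun p : Z2 * Z2 => phase R k p.1 p.2 * a p.1 * b p.2).
Proof.
move=> sa sb; rewrite (_ : (fun p => _) = fun p => phase R k p.1 p.2 * (a p.1 * b p.2)).
  by apply: (csummableM (csummable_prod sa sb) (M := 1)) => p; rewrite normc_phase.
by apply/funext => p; rewrite mulrA.
Qed.

(** Orthogonality of characters, integrated term by term: [chi (l - (m + m'))] has integral 1 if m +
    m' = l and 0 otherwise. *)
Lemma fc_tconv a b l : csummable a -> csummable b ->
  fc (fun y => csum (fun p : Z2 * Z2 =>
    phase R k p.1 p.2 * a p.1 * b p.2 * chi (- (p.1 + p.2)) y)) l = tconv a b l.
Proof.
move=> sa sb; rewrite /fc /tconv; set F := fun p : Z2 * Z2 => phase R k p.1 p.2 * a p.1 * b p.2.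
have sF : csummable F := csummable_phase sa sb.
have cF p : ccont (fun y => F p * chi (l - (p.1 + p.2)) y).
  by apply: ccontM; [exact: ccont_cst|exact: ccont_chi].
have bF p y : Normc.normc (F p * chi (l - (p.1 + p.2)) y) <= Normc.normc (F p).
  by rewrite Normc.normcM normc_chi mulr1.
have [_ E] := cint2_csum sF cF bF.
rewrite (_ : (fun y => _) = fun y => csum (fun p => F p * chi (l - (p.1 + p.2)) y)).
  rewrite E; congr csum; apply/funext => p.
  rewrite (cint2Z _ (ccont_chi R _)) cint2_chi subr_eq0 eq_sym.
  by case: eqP; rewrite ?mulr1 ?mulr0.
apply/funext => y; rewrite mulrC -csumZ; last first.
  rewrite (_ : (fun p => _) = fun p : Z2 * Z2 => chi (- (p.1 + p.2)) y * F p).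
    by apply: (csummableM sF (M := 1)) => p; rewrite normc_chi.
  by apply/funext => p; rewrite mulrC.
congr csum; apply/funext => p; rewrite chiD; set c := F p; rewrite -/(F p) -/c.
by rewrite mulrCA.
Qed.

Lemma csummable_fiber (T S : choiceType) (h : T -> S) (F : T -> C) : csummable F ->
  csummable (fun p : T * S => if h p.1 == p.2 then F p.1 else 0).
Proof.
move=> sF; rewrite /csummable /rsummable /summable ge0_esum_pair //=.
apply: le_lt_trans sF; apply: le_esum => t _.
rewrite (_ : (fun s => _) = fun s => (if s == h t then `|Normc.normc (F t)| else 0)%:E).
  by rewrite esum_delta //= normr_ge0.
by apply/funext => s; rewrite eq_sym; case: ifP; rewrite // Normc.normc0 normr0.
Qed.

(** The family is placed on the graph of [h] inside T x S and Fubini is applied in both orders: each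
    row has a single term, each column is a fibre. *)
Lemma csum_fiber (T S : choiceType) (h : T -> S) (F : T -> C) : csummable F ->
  csum F = csum (fun s => csum (fun t => if h t == s then F t else 0)).
Proof.
move=> sF; have sG := csummable_fiber h sF.
have bsw : bijective (fun p : S * T => (p.2, p.1)).
  by exists (fun p => (p.2, p.1)) => -[].
have [_ E1] := csum_pair sG.
have [_ E2] := csum_pair (csummable_reindex bsw sG).
move: E2; rewrite -(csum_reindex _ bsw) => <-; rewrite E1 /=; congr csum; apply/funext => t.
rewrite -[LHS](csum_delta (h t)); congr csum; apply/funext => s.
by rewrite eq_sym.
Qed.

End TwistedConvolution.

(** * Absolutely summable families acting through Weyl operators *)

Section Representation.
Variables (R : realType) (k : nat).
Hypothesis k_gt0 : (0 < k)%N.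
Local Notation C := R[i].
Local Notation V := (R * R)%type.
Local Notation Z2 := (int * int)%type.
Variables (n : nat) (cd : chart_data R n) (U : chart n) (x : R * R).
Variables (yc : R * R) (J : R * R -> R * R) (eps : bool * bool).
Local Notation H := (polarized cd k U x yc J eps).
Implicit Types (a b : Z2 -> C) (m l : Z2) (psi phi : V -> C).

Definition weyl_rep a psi : V -> C := fun y => csum (fun m => a m * weyl k m psi y).

Definition residue_of (r : 'I_(2 * k) * 'I_(2 * k)) : Z2 := ((r.1 : nat)%:Z, (r.2 : nat)%:Z).

Lemma residueP m : exists r, forall s, (residue k m == residue_of s) = (s == r).
Proof.
have N0 : (2 * k)%:Z != 0 by lia.
have absE j : (absz (j %% (2 * k)%:Z)%Z)%:Z = (j %% (2 * k)%:Z)%Z.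
  by rewrite gez0_abs // modz_ge0.
have lt j : (absz (j %% (2 * k)%:Z)%Z < 2 * k)%N.
  by rewrite -ltz_nat absE ltz_pmod //; lia.
exists (Ordinal (lt m.1), Ordinal (lt m.2)) => -[s1 s2].
rewrite /residue /residue_of !xpair_eqE -!val_eqE /=.
congr (_ && _); rewrite -absE eqz_nat; exact: eq_sym.
Qed.

Lemma sum_residue (z : C) m (F : Z2 -> C) :
  z * F (residue k m) =
  \sum_(r : 'I_(2 * k) * 'I_(2 * k))
    (if residue k m == residue_of r then z else 0) * F (residue_of r).
Proof.
have [r rP] := residueP m; rewrite (bigD1 r) //= rP eqxx big1 ?addr0.
  by move: (rP r); rewrite eqxx => /eqP ->.
by move=> s /negbTE sr; rewrite rP sr mul0r.
Qed.

(** Up to unit scalars only the (2k)^2 residues occur, so the sum of their moduli bounds every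
    term. *)
Lemma weyl_bounded psi y : H psi -> exists M, forall m, Normc.normc (weyl k m psi y) <= M.
Proof.
move=> Hpsi.
exists (\sum_(r : 'I_(2 * k) * 'I_(2 * k)) Normc.normc (weyl k (residue_of r) psi y)) => m.
have [z z1 ->] := weyl_residue k_gt0 cd U x yc J eps m; last exact: Hpsi.
have [r /(_ r)] := residueP m; rewrite eqxx => /eqP ->.
rewrite Normc.normcM z1 mul1r (bigD1 r) //= lerDl sumr_ge0 // => s _.
exact: normc_ge0.
Qed.

Lemma csummable_weyl a psi y : csummable a -> H psi ->
  csummable (fun m => a m * weyl k m psi y).
Proof.
move=> sa Hpsi; have [M wM] := weyl_bounded y Hpsi.
under eq_fun do rewrite mulrC; exact: csummableM sa wM.
Qed.

Lemma weyl_rep_polarized a psi : csummable a -> H psi -> H (weyl_rep a psi).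
Proof.
move=> sa Hpsi.
have /choice[z zP] m : exists z : C, Normc.normc z = 1 /\
    forall y, weyl k m psi y = z * weyl k (residue k m) psi y.
  have [z z1 zw] := weyl_residue k_gt0 cd U x yc J eps m.
  by exists z; split => // y; exact: zw.
(* The part of [a] supported on the residue class [r], with the unit scalars absorbed; its sum is
   the coefficient of one Weyl operator in a finite linear combination. *)
pose t r m := if residue k m == residue_of r then z m * a m else 0.
have st r : csummable (t r).
  rewrite (_ : t r = fun m => (if residue k m == residue_of r then z m else 0) * a m).
    apply: (csummableM sa (M := 1)) => m; case: ifP => _; last by rewrite Normc.normc0 ler01.
    by have [-> _] := zP m.
  by apply/funext => m; rewrite /t; case: ifP; rewrite ?mul0r.
rewrite (_ : weyl_rep a psi = fun y =>
    \sum_(r : 'I_(2 * k) * 'I_(2 * k)) csum (t r) * weyl k (residue_of r) psi y).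
  by apply: (polarized_sum _ _ Hpsi) => r; exact: (weyl_polarized k_gt0 _ Hpsi).
apply/funext => y; rewrite /weyl_rep.
rewrite (_ : (fun m => _) = fun m =>
    \sum_(r : 'I_(2 * k) * 'I_(2 * k)) weyl k (residue_of r) psi y * t r m).
  rewrite csum_sum => [|r]; last exact: csummableZ.
  by apply: eq_bigr => r _; rewrite (csumZ _ (st r)) mulrC.
apply/funext => m; have [_ ->] := zP m.
rewrite mulrA [a m * _]mulrC (sum_residue _ m (fun r => weyl k r psi y)).
by apply: eq_bigr => r _; exact: mulrC.
Qed.

Lemma weyl_rep_linr a (t : C) psi phi : csummable a -> H psi -> H phi ->
  weyl_rep a (fun y => t * psi y + phi y) = fun y => t * weyl_rep a psi y + weyl_rep a phi y.
Proof.
move=> sa Hpsi Hphi; apply/funext => y; rewrite /weyl_rep.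
have [s1 s2] := (csummable_weyl y sa Hpsi, csummable_weyl y sa Hphi).
rewrite -(csumZ t s1) -csumD //; last exact: csummableZ.
congr csum; apply/funext => m; rewrite /weyl.
set e := weyl_factor _ _ _; set p1 := psi _; set p2 := phi _.
by clearbody e p1 p2; ring.
Qed.

Lemma weyl_rep_linl a b (t : C) psi : csummable a -> csummable b -> H psi ->
  weyl_rep (fun m => t * a m + b m) psi = fun y => t * weyl_rep a psi y + weyl_rep b psi y.
Proof.
move=> sa sb Hpsi; apply/funext => y; rewrite /weyl_rep.
have [s1 s2] := (csummable_weyl y sa Hpsi, csummable_weyl y sb Hpsi).
rewrite -(csumZ t s1) -csumD //; last exact: csummableZ.
by congr csum; apply/funext => m; rewrite mulrDl mulrA.
Qed.

Lemma weyl_rep1 psi : weyl_rep (fun m => if m == 0 then 1 else 0) psi = psi.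
Proof.
apply/funext => y; rewrite /weyl_rep -[RHS](csum_delta (0 : Z2)).
congr csum; apply/funext => m; case: eqP => [->|_]; last by rewrite mul0r.
by rewrite weyl0 mul1r.
Qed.

Lemma weyl_rep_tconv a b psi : csummable a -> csummable b -> H psi ->
  weyl_rep (tconv k a b) psi = weyl_rep a (weyl_rep b psi).
Proof.
move=> sa sb Hpsi; apply/funext => y.
pose F (p : Z2 * Z2) := phase R k p.1 p.2 * a p.1 * b p.2.
have sF : csummable F := csummable_phase k sa sb.
have [M wM] := weyl_bounded y Hpsi.
pose G p := weyl k (p.1 + p.2) psi y * F p.
have sG : csummable G by exact: csummableM sF (fun p => wM (p.1 + p.2)).
(* A single absolutely summable double sum: grouped by m + l it is the action of the convolution,
   iterated over [m] then [l] it is the composite of the two actions. *)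
transitivity (csum G).
  rewrite (csum_fiber (fun p : Z2 * Z2 => p.1 + p.2) sG) /weyl_rep; congr csum.
  apply/funext => l; rewrite /tconv mulrC -csumZ; last first.
    apply: csummable_le sF _ => p; case: ifP => _ //.
    by rewrite Normc.normc0 normc_ge0.
  by congr csum; apply/funext => p; rewrite /G; case: eqP => [<-|] //; rewrite mulr0.
have [_ ->] := csum_pair sG; rewrite /weyl_rep; congr csum; apply/funext => m.
rewrite {1}/weyl -csumZ; last exact: csummable_weyl sb Hpsi.
rewrite -csumZ; last exact/csummableZ/csummable_weyl.
congr csum; apply/funext => l; rewrite /G /F /=.
have := weyl_comp k_gt0 m l psi y; rewrite {1}/weyl => E.
rewrite [weyl_factor k m y * _]mulrCA E; set w := weyl _ _ _ _; set ph := phase _ _ _ _.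
by clearbody w ph; ring.
Qed.

End Representation.

(** * Fibres of the action-angle charts *)


Section Slices.
Variables (R : realType) (V W : normedModType R).

Lemma derive_slice (G : V * W -> R) (c : V) (v y : W) :
  'D_v (fun y => G (c, y)) y = 'D_(0, v) G (c, y).
Proof.
rewrite /derive; set f := fun h => _; set g := fun h => _.
rewrite (_ : f = g) //; apply/funext => h; rewrite /f /g /=.
congr (_ *: (G _ - _)); apply: injective_projections => /=; last by [].
by rewrite scaler0 add0r.
Qed.

(** Iterated derivatives of the slice are those of [G] along the vectors (0, v), and the whole slice
    lies in [D]. *)
Lemma smooth_slice (D : set (V * W)) (G : V * W -> R) (c : V) :
  smooth D G -> (forall y, D (c, y)) -> smooth setT (fun y => G (c, y)).
Proof.
move=> sG Dc vs y _.
have -> : foldr (fun v (h : W -> R) => 'D_v h) (fun y => G (c, y)) vs =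
    fun y => foldr (fun v (h : V * W -> R) => 'D_v h) G [seq (0, v) | v <- vs] (c, y).
  elim: vs => [//|v vs IH] /=; rewrite IH; apply/funext => z; exact: derive_slice.
apply: (@differentiable_comp _ _ _ _ (fun y : W => (c, y)) (foldr _ G _)); last exact: sG.
by apply: differentiable_pair.
Qed.

End Slices.

Section Charts.
Variables (R : realType).
Local Notation C := R[i].

Lemma cexp_real (t : R) : cexp t%:C = (expR t)%:C.
Proof. by rewrite cexpE cis0 mulr1. Qed.

Lemma cexp_complex (s t : R) : cexp (s%:C + cI R * t%:C) = (expR s)%:C * cis t.
Proof. by rewrite cexpD cexp_real cexp_cI. Qed.

Lemma cexp_complexz (s t : R) (j : int) :
  cexp (s%:C + cI R * t%:C) ^ j = cexp ((s *~ j)%:C + cI R * (t *~ j)%:C).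
Proof.
by rewrite -cexp_int mulrzDl !rmorphMz mulrzAr.
Qed.

(** The absolute value of u^m1 w^m2, which depends on the action coordinates only and is therefore
    constant on a fibre. *)
Definition modulus (x : R * R) (m : int * int) : C :=
  (expR (pi * (m.1%:~R * x.1 + m.2%:~R * x.2)))%:C.

Lemma modulusD x m l : modulus x (m + l) = modulus x m * modulus x l.
Proof. by rewrite /modulus -rmorphM -expRD; congr ((expR _)%:C); rewrite !rmorphD /=; ring. Qed.

Lemma modulusN x m : modulus x (- m) * modulus x m = 1.
Proof. by rewrite -modulusD addNr /modulus /= !mul0r addr0 mulr0 expR0. Qed.

Lemma monoE m (x y : R * R) : mono m (x, y) = modulus x m * chi (- m) y.
Proof.
rewrite /mono /ucoord /wcoord -mulrN -rmorphN !cexp_complexz -cexpD.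
rewrite addrACA -rmorphD -mulrDr -rmorphD cexp_complex /modulus /chi /=.
have -> : pi * x.1 *~ m.1 + pi * x.2 *~ m.2 = pi * (m.1%:~R * x.1 + m.2%:~R * x.2).
  by rewrite -(mulrzr (pi * x.1)) -(mulrzr (pi * x.2)); ring.
have -> : (- (2 * pi * y.2)) *~ m.1 + 2 * pi * y.1 *~ m.2 =
    2 * pi * ((- m.1)%:~R * y.2 - (- m.2)%:~R * y.1).
  by rewrite -(mulrzr (- _)) -(mulrzr (_ * y.1)) !rmorphN; ring.
by [].
Qed.

Variables (n : nat) (f : {poly C}) (a : 'I_n.+1 -> C) (swap : bool) (cd : chart_data R n).
Variables (U : chart n) (x : R * R).
Hypothesis atlas : is_action_angle_atlas f a swap cd.
Hypothesis xU : chart_dom a swap U x.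
Implicit Types (g h : C * C * C -> C).

Definition on_fiber g (y : R * R) : C := g (param cd U (action cd U x, y)).

Lemma on_fiber_eq (W : set (R * R)) g h : W x ->
  (forall P, totalX f P -> W (fib P) -> chart_dom a swap U (fib P) -> g P = h P) ->
  on_fiber g = on_fiber h.
Proof.
move=> Wx gh; apply/funext => y.
have [chartU _ _ _] := atlas; have [_ _ [inX _] _ _] := chartU U.
by have [tX fx] := inX x y xU; apply: gh; rewrite ?fx.
Qed.

Lemma on_fiber_periodic g : periodic (on_fiber g).
Proof.
move=> m y; have [chartU _ _ _] := atlas; have [_ _ _ per _] := chartU U.
rewrite /on_fiber; congr g; apply/esym/(per x y _ xU); by exists m.
Qed.

Lemma on_fiber_csmooth (W : set (R * R)) g : W x -> holomorphic a swap cd U W g ->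
  csmooth setT (on_fiber g).
Proof.
move=> Wx [[sr si] _].
have im y : chart_image a swap cd U W (action cd U x, y) by exists x.
split; [exact: smooth_slice sr im|exact: smooth_slice si im].
Qed.

Lemma csummable_on_fiber (W : set (R * R)) g : W x -> holomorphic a swap cd U W g ->
  csummable (fc (on_fiber g)).
Proof.
by move=> Wx hg; exact: csummable_fc (on_fiber_csmooth Wx hg) (on_fiber_periodic g).
Qed.

Lemma ccont_on_fiber (W : set (R * R)) g : W x -> holomorphic a swap cd U W g ->
  ccont (on_fiber g).
Proof.
by move=> Wx /(on_fiber_csmooth Wx)[sr si]; split; exact: smooth_continuous.
Qed.

Lemma coef_on_fiber g m : ccont (on_fiber g) ->
  coef cd U g x m = modulus (action cd U x) (- m) * fc (on_fiber g) m.
Proof.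
move=> cg; rewrite /coef /fc -(cint2Z _ (ccontM cg (ccont_chi R m))).
congr cint2; apply/funext => y; rewrite monoE opprK -/(on_fiber g y).
by rewrite mulrCA.
Qed.

(** [coords] recovers angles by choice, hence only up to Z^2; the periodicity of [chi] makes the
    monomial insensitive to it. The default of [xget] is not reached, as [y] itself is a
    candidate. *)
Lemma mono_coords m y : mono m (coords cd U (param cd U (action cd U x, y))) =
  modulus (action cd U x) m * chi (- m) y.
Proof.
have [chartU _ _ _] := atlas; have [_ _ [inX _] per _] := chartU U.
have [tX fx] := inX x y xU.
rewrite /coords fx monoE; congr (_ * _).
have := @xgetPex _ (0, 0) [set y' | param cd U (action cd U x, y') = param cd U (action cd U x, y)].
move=> /(_ (ex_intro _ y erefl)); set y' := xget _ _ => /= /esym /(per x y y' xU)[l ->].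
exact: chi_periodic.
Qed.

Variable k : nat.

(** The two Laurent coefficients carry the moduli of -m and -m', the monomial that of m + m'. Their
    product is 1, so on the fibre the star product is a twisted convolution of Fourier
    coefficients. *)
Lemma fc_star (W W' : set (R * R)) g h : W x -> W' x ->
  holomorphic a swap cd U W g -> holomorphic a swap cd U W' h ->
  fc (on_fiber (star_chart cd k U g h)) = tconv k (fc (on_fiber g)) (fc (on_fiber h)).
Proof.
move=> Wx W'x hg hh; apply/funext => l.
rewrite -fc_tconv; [|exact: csummable_on_fiber Wx hg|exact: csummable_on_fiber W'x hh].
apply: (congr1 (fun F => fc F l)); apply/funext => y.
rewrite [LHS]/on_fiber /star_chart.
have [chartU _ _ _] := atlas; have [_ _ [inX _] _ _] := chartU U.
have [_ ->] := inX x y xU.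
congr csum; apply/funext => -[m m'] /=.
rewrite !coef_on_fiber; [|exact: ccont_on_fiber W'x hh|exact: ccont_on_fiber Wx hg].
rewrite mono_coords modulusD.
have E := modulusN (action cd U x) m; have E' := modulusN (action cd U x) m'.
set u := modulus _ m in E *; set v := modulus _ (- m) in E *.
set u' := modulus _ m' in E' *; set v' := modulus _ (- m') in E' *.
set s := fc _ m; set t := fc _ m'; set p := phase _ _ _ _; set z := chi _ y.
clearbody u v u' v' s t p z.
rewrite -[RHS]mul1r -[1]mulr1 -{1}E -E'; ring.
Qed.

End Charts.

(** * The action of Cech cocycles on the polarized sections of one fibre *)

Theorem corollary1p2 (R : realType) (n : nat)
    (f : {poly R[i]}) (a : 'I_n.+1 -> R[i])
    (size_f : size f = n.+2)
    (root_f : forall i, root f (a i))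
    (a_neq0 : forall i, a i != 0)
    (a_decr : forall i j : 'I_n.+1, (i < j)%N -> Normc.normc (a j) < Normc.normc (a i))
    (swap : bool) (cd : chart_data R n)
    (cd_atlas : is_action_angle_atlas f a swap cd)
    (k : nat) (k_gt0 : (0 < k)%N)
    (U : chart n) (x : R * R) (xU : chart_dom a swap U x)
    (yc : R * R) (J : R * R -> R * R) (HJ : flat_complex_structure J)
    (eps : bool * bool) :
  exists rho : cover R -> cochain R n -> (R * R -> R[i]) -> (R * R -> R[i]),
    is_left_action f a swap cd k (polarized cd k U x yc J eps) rho.
Proof.
pose sel (cU : cover R) : set (R * R) := xget setT [set W | cU W /\ W x].
pose F (c : cochain R n) (W : set (R * R)) := on_fiber cd U x (c [:: W] U).
have selP cU : is_open_cover cU -> cU (sel cU) /\ sel cU x.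
  move=> [_ /(_ x)[W cW Wx]].
  exact: (@xgetPex _ setT [set W | cU W /\ W x] (ex_intro _ W (conj cW Wx))).
have splx (cU : cover R) W : cU W -> simplex cU [:: W].
  by move=> cW; split => // W'; rewrite inE => /eqP ->.
have inter1 (W : set (R * R)) : W x -> inter [:: W] x by move=> Wx; rewrite /inter big_seq1.
have hol cU c W : is_cocycle f a swap cd k cU c -> cU W ->
    holomorphic a swap cd U (inter [:: W]) (c [:: W] U).
  by move=> [[sc _] _] /splx /sc[].
have sumF cU c W : is_cocycle f a swap cd k cU c -> cU W -> W x -> csummable (fc (F c W)).
  move=> cc cW Wx.
  exact: (csummable_on_fiber cd_atlas xU (inter1 W Wx) (hol cU c W cc cW)).
have contF cU c W : is_cocycle f a swap cd k cU c -> cU W -> W x -> ccont (F c W).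
  move=> cc cW Wx; exact: (ccont_on_fiber xU (inter1 W Wx) (hol cU c W cc cW)).
(* On the two-term sequence the coboundary is the difference of the components on [W'] and [W], so a
   cocycle has the same restriction to the fibre from either. *)
have indep cU c W W' : is_cocycle f a swap cd k cU c -> cU W -> W x -> cU W' -> W' x ->
    F c W = F c W'.
  move=> [_ cob] cW Wx cW' W'x.
  have sp : simplex cU [:: W; W'].
    by split => // V; rewrite !inE => /orP[] /eqP ->.
  have iX : inter [:: W; W'] x by rewrite /inter big_cons big_seq1.
  apply: (on_fiber_eq cd_atlas xU iX) => P tX iP dP.
  have := cob _ sp U P tX iP dP.
  rewrite /coboundary /= !big_ord_recl big_ord0 /= expr0 expr1 addr0 mul1r mulN1r.
  by move=> /eqP; rewrite subr_eq0 => /eqP.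
exists (fun cU c psi => weyl_rep k (fc (F c (sel cU))) psi); split.
- move=> cU c psi oU cc Hpsi; have [cW Wx] := selP cU oU.
  exact: weyl_rep_polarized (sumF _ _ _ cc cW Wx) Hpsi.
- move=> cU c cV d psi oU cc oV dd Hpsi [cW [r [r' [e [oW rU rV ce coh]]]]].
  have [cS Sx] := selP cW oW; have [cWU WUx] := selP cU oU; have [cWV WVx] := selP cV oV.
  have [rS SrS] := rU _ cS; have [rS' SrS'] := rV _ cS.
  (* Both cocycles are moved to the members that the refinement maps assign to one set around [x],
     where the cohomology relation compares them. *)
  rewrite (indep cU c _ (r (sel cW)) cc cWU WUx rS (SrS _ Sx)).
  rewrite (indep cV d _ (r' (sel cW)) dd cWV WVx rS' (SrS' _ Sx)).
  congr (weyl_rep k (fc _) psi).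
  apply: (on_fiber_eq cd_atlas xU (inter1 _ Sx)) => P tX iP dP.
  have := coh _ (splx _ _ cS) U P tX iP dP.
  (* A coboundary is 0 on one-element sequences, so cohomologous cocycles agree there exactly. *)
  by rewrite /coboundary /= => /eqP; rewrite subr_eq0 => /eqP.
- move=> cU c t psi phi oU cc Hpsi Hphi; have [cW Wx] := selP cU oU.
  exact: (weyl_rep_linr k_gt0 t (sumF _ _ _ cc cW Wx) Hpsi Hphi).
- move=> cU c d t psi oU cc dd Hpsi; have [cW Wx] := selP cU oU.
  have [cF dF] := (contF _ _ _ cc cW Wx, contF _ _ _ dd cW Wx).
  rewrite -(weyl_rep_linl k_gt0 t (sumF _ _ _ cc cW Wx) (sumF _ _ _ dd cW Wx) Hpsi).
  congr (weyl_rep k _ psi); apply/funext => m.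
  rewrite -(fcZ _ _ cF) -fcD //.
  by apply: ccontM => //; exact: ccont_cst.
- move=> cU psi oU Hpsi; have [cW Wx] := selP cU oU; split.
    (* The constant function 1 has the delta family at 0 as Fourier coefficients, and this acts as
       the Weyl operator of index 0, the identity. *)
    rewrite -[RHS](weyl_rep1 k); congr (weyl_rep k _ psi); apply/funext => m.
    exact: fc_cst.
  move=> c d cc dd.
  rewrite -(weyl_rep_tconv k_gt0 (sumF _ _ _ cc cW Wx) (sumF _ _ _ dd cW Wx) Hpsi).
  congr (weyl_rep k _ psi).
  have W1 := inter1 _ Wx.
  rewrite -(fc_star cd_atlas xU k W1 W1 (hol _ _ _ cc cW) (hol _ _ _ dd cW)).
  congr fc; apply/funext => y; rewrite /F /on_fiber /cup.
  (* On a one-element sequence the cup product has a single term, the star product of the two degree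
     0 components. *)
  by rewrite big_ord_recl big_ord0 addr0.
Qed.
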